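(* Let $f:\mathbb{T}^n_{\hat\rho}\to\mathbb{C}$ be an analytic and bounded function in the complex strip $\mathbb{T}^n_{\hat\rho}$ of size $\hat\rho>0$. Let $\tilde f$ be the discrete Fourier approximation of $f$ in the regular grid of size $N_F=(N_{F,1},\dots,N_{F,n})\in\mathbb{N}^n$. Then $$\|\tilde f-f\|_\rho\le C_{N_F}(\rho,\hat\rho)\,\|f\|_{\hat\rho}$$ for $0\le\rho<\hat\rho$, where $C_{N_F}(\rho,\hat\rho)=S^{*1}_{N_F}(\rho,\hat\rho)+S^{*2}_{N_F}(\rho,\hat\rho)+T_{N_F}(\rho,\hat\rho)$ is given by $$S^{*1}_{N_F}(\rho,\hat\rho)=\prod_{\ell=1}^n\frac{1}{1-e^{-2\pi\hat\rho N_{F,\ell}}}\sum_{\substack{\sigma\in\{-1,1\}^n\\ \sigma\ne(1,\dots,1)}}\prod_{\ell=1}^n e^{(\sigma_\ell-1)\pi\hat\rho N_{F,\ell}}\,\nu_{N_{F,\ell}}(\sigma_\ell\hat\rho-\rho),$$ $$S^{*2}_{N_F}(\rho,\hat\rho)=\prod_{\ell=1}^n\frac{1}{1-e^{-2\pi\hat\rho N_{F,\ell}}}\left(1-\prod_{\ell=1}^n\left(1-e^{-2\pi\hat\rho N_{F,\ell}}\right)\right)\prod_{\ell=1}^n\nu_{N_{F,\ell}}(\hat\rho-\rho),$$ $$T_{N_F}(\rho,\hat\rho)=\left(\frac{e^{2\pi(\hat\rho-\rho)}+1}{e^{2\pi(\hat\rho-\rho)}-1}\right)^n\left(1-\prod_{\ell=1}^n\left(1-\mu_{N_{F,\ell}}(\hat\rho-\rho)\,e^{-\pi(\hat\rho-\rho)N_{F,\ell}}\right)\right),$$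 with $$\nu_{N_{F,\ell}}(\delta)=\frac{e^{2\pi\delta}+1}{e^{2\pi\delta}-1}\left(1-\mu_{N_{F,\ell}}(\delta)\,e^{-\pi\delta N_{F,\ell}}\right),\qquad \mu_{N_{F,\ell}}(\delta)=\begin{cases}1&\text{if }N_{F,\ell}\text{ is even},\\ \dfrac{2e^{\pi\delta}}{e^{2\pi\delta}+1}&\text{if }N_{F,\ell}\text{ is odd}.\end{cases}$$
   Context: $\mathbb{T}^n=\mathbb{R}^n/\mathbb{Z}^n$ and $\mathbb{T}^n_\rho=\{\theta\in\mathbb{C}^n/\mathbb{Z}^n:|\mathrm{Im}\,\theta_i|<\rho,\ i=1,\dots,n\}$; $\|u\|_\rho=\sup_{\theta\in\mathbb{T}^n_\rho}|u(\theta)|$, and for $\rho=0$ the supremum is over the real torus $\mathbb{T}^n$. Discrete Fourier approximation: on the grid $\theta_j=(j_1/N_{F,1},\dots,j_n/N_{F,n})$, $0\le j_\ell<N_{F,\ell}$, put $f_j=f(\theta_j)$ and $N_D=N_{F,1}\cdots N_{F,n}$, and define $$\tilde f_k=\frac1{N_D}\sum_{0\le j<N_F}f_j\,e^{-2\pi i k\cdot\theta_j},\qquad \tilde f(\theta)=\sum_{k\in I_{N_F}}\tilde f_k\,e^{2\pi i k\cdot\theta},$$ where $I_{N_F}=\{k\in\mathbb{Z}^n:-N_{F,\ell}/2\le k_\ell<N_{F,\ell}/2,\ 1\le\ell\le n\}$. *)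

(* Defs.v *)
From HB Require Import structures.
From mathcomp Require Import all_boot all_order all_algebra.
From mathcomp Require Import finmap complex summability.
From mathcomp Require Import all_classical all_reals all_analysis.

Set Implicit Arguments.
Unset Strict Implicit.
Unset Printing Implicit Defensive.
Import Order.TTheory GRing.Theory Num.Theory numFieldNormedType.Exports.

Local Open Scope classical_set_scope.
Local Open Scope complex_scope.
Local Open Scope ring_scope.

(* A point of C^n/Z^n is represented by any of its lifts to C^n, and a function
   on a complex strip of the torus by a total function on C^n that is
   Z^n-periodic on (the lift of) the strip; its values elsewhere are
   irrelevant. *)

Section TorusFunctions.
Variables (R : realType) (n : nat).
Implicit Types (rho : R) (U : set 'rV[R[i]]_n) (f : 'rV[R[i]]_n -> R[i]).

Definition cstrip rho : set 'rV[R[i]]_n :=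
  [set theta : 'rV[R[i]]_n | forall l, `|complex.Im (theta 0 l)| < rho].

Definition real_torus : set 'rV[R[i]]_n :=
  [set theta : 'rV[R[i]]_n | forall l, complex.Im (theta 0 l) = 0].

Definition periodic_on U f : Prop :=
  forall (theta : 'rV[R[i]]_n) (k : 'rV[int]_n),
    U theta -> f (theta + map_mx intr k) = f theta.

Definition bounded_on U f : Prop :=
  exists M : R, forall theta, U theta -> Normc.normc (f theta) <= M.

(* Around each point of U, f is the sum of a power series in n variables; the
   sum over multi-indices is the limit along the finite sets of multi-indices
   (unconditional convergence). *)
Definition analytic_on U f : Prop :=
  forall theta0 : 'rV[R[i]]_n, U theta0 ->
  exists (r : R) (c : {ffun 'I_n -> nat} -> R[i]), 0 < r /\
  forall theta : 'rV[R[i]]_n,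
    (forall l, Normc.normc (theta 0 l - theta0 0 l) < r) ->
    partial_sum (fun a : {ffun 'I_n -> nat} =>
        c a * \prod_(l < n) (theta 0 l - theta0 0 l) ^+ a l : R[i]^o) @ totally
      --> (f theta : R[i]^o).

(* The sup norm with values in [-oo, +oo], so that it is meaningful without a
   prior proof of boundedness. *)
Definition supnorm rho f : \bar R :=
  ereal_sup [set (Normc.normc (f theta))%:E | theta in
             if rho == 0 then real_torus else cstrip rho].

End TorusFunctions.
Arguments cstrip {R n} rho.
Arguments real_torus {R n}.

Section DiscreteFourier.
Variables (R : realType) (n : nat).
Implicit Types (N : 'I_n -> nat) (f : 'rV[R[i]]_n -> R[i]).

Definition cexp (z : R[i]) : R[i] :=
  (expR (complex.Re z))%:C *
  (cos (complex.Im z) +i* sin (complex.Im z)).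

(* 2 pi i (k . theta) *)
Definition phase (k : 'rV[int]_n) (theta : 'rV[R[i]]_n) : R[i] :=
  (0 +i* (2 * pi)) * \sum_(l < n) (k 0 l)%:~R * theta 0 l.

Definition grid_point N (j : {dffun forall l : 'I_n, 'I_(N l)}) :
    'rV[R[i]]_n :=
  \row_l ((j l)%:R / (N l)%:R).

Definition dft_coef N f (k : 'rV[int]_n) : R[i] :=
  (\prod_(l < n) (N l)%:R)^-1 *
  \sum_(j : {dffun forall l : 'I_n, 'I_(N l)})
    f (grid_point j) * cexp (- phase k (grid_point j)).

Definition freq_set N : set 'rV[int]_n :=
  [set k : 'rV[int]_n | forall l,
    - ((N l)%:Q / 2) <= (k 0 l)%:Q < (N l)%:Q / 2].

Definition dft_approx N f (theta : 'rV[R[i]]_n) : R[i] :=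
  \sum_(k \in freq_set N) dft_coef N f k * cexp (phase k theta).

End DiscreteFourier.

Section Constants.
Variables (R : realType).
Implicit Types (delta rho rhohat : R).

Definition mu (N : nat) delta : R :=
  if odd N then 2 * expR (pi * delta) / (expR (2 * pi * delta) + 1) else 1.

Definition nu (N : nat) delta : R :=
  (expR (2 * pi * delta) + 1) / (expR (2 * pi * delta) - 1) *
  (1 - mu N delta * expR (- (pi * delta * N%:R))).

Variable n : nat.
Implicit Types (N : 'I_n -> nat).

(* A sign vector in {-1, 1}^n is encoded by s : {ffun 'I_n -> bool}, with l-th
   component (-1) ^+ s l; the vector (1, ..., 1) is [ffun=> false]. *)
Definition Sstar1 N rho rhohat : R :=
  (\prod_(l < n) (1 - expR (- (2 * pi * rhohat * (N l)%:R)))^-1) *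
  \sum_(s : {ffun 'I_n -> bool} | s != [ffun=> false])
    \prod_(l < n)
      (expR (((-1) ^+ s l - 1) * pi * rhohat * (N l)%:R) *
       nu (N l) ((-1) ^+ s l * rhohat - rho)).

Definition Sstar2 N rho rhohat : R :=
  (\prod_(l < n) (1 - expR (- (2 * pi * rhohat * (N l)%:R)))^-1) *
  (1 - \prod_(l < n) (1 - expR (- (2 * pi * rhohat * (N l)%:R)))) *
  \prod_(l < n) nu (N l) (rhohat - rho).

Definition Tconst N rho rhohat : R :=
  ((expR (2 * pi * (rhohat - rho)) + 1) /
   (expR (2 * pi * (rhohat - rho)) - 1)) ^+ n *
  (1 - \prod_(l < n)
         (1 - mu (N l) (rhohat - rho) *
              expR (- (pi * (rhohat - rho) * (N l)%:R)))).

Definition CN N rho rhohat : R :=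
  Sstar1 N rho rhohat + Sstar2 N rho rhohat + Tconst N rho rhohat.

End Constants.

(* Main.v *)
Require Import Defs.
From mathcomp Require Import all_boot all_order all_algebra.
From mathcomp Require Import finmap complex summability.
From mathcomp Require Import all_classical all_reals all_analysis.
From mathcomp Require Import ring lra zify.
Import Order.TTheory GRing.Theory Num.Theory numFieldNormedType.Exports.

(** Write e_k(z) = exp (2 pi i k z), r_m = exp (- 2 pi h |m|) with h the size of
    the strip, and let I_N be the window of N frequencies. The bound is a bound
    on operators that act on one variable at a time. In one variable, the grid
    operator P (sampling on N points, then trigonometric interpolation at a
    point th) and the evaluation at th are both compared with the truncation Q
    of the Fourier series to I_N. On functions bounded by 1 on the strip, whose
    Fourier coefficients satisfy |c_m| <= r_m, one gets
      - |Q| <= nu_N (h - rho), the sum of r_k exp (2 pi rho |k|) over k in I_N;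
      - |P - Q| <= A - nu_N (h - rho), because P sends e_m to e_k with k in I_N
        congruent to m mod N (aliasing), A being the sum of
        r_m exp (2 pi rho |k|) over all m;
      - |ev - Q| <= c - nu_N (h - rho), where c is the sum of
        r_m exp (2 pi rho |m|) over all m.
    Since |S - T| <= a_l and |T| <= q_l in each variable give
    prod (q_l + a_l) - prod q_l for the difference of the tensor products
    ([act_coords_diff_bounded]), the error in n variables is at most
      (prod A_l - prod nu_l) + (c ^ n - prod nu_l),
    and this is C_N: the first difference is S*1 + S*2 and the second is T
    ([CN_split]).

    No integral is used. A functional is a finite combination of point
    evaluations, and [functional_bound] says that such a functional F satisfies
    |F g| <= M sum_m r_m |F e_m| when g is holomorphic, 1-periodic and bounded
    by M on the strip. Its proof needs the decay of Fourier coefficients and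
    the summation of Fourier series, both for Riemann sums on L points instead
    of integrals. Decay comes from moving the line of summation: the discrete
    Cauchy-Riemann relation g(z + i t) - g(z) = i (g(z + t) - g(z)) + o(t) is
    uniform on compact sets ([uniform_CR]), and summed over a horizontal period
    its right-hand side telescopes, so that averages on two horizontal lines
    differ by o(1) as L grows ([line_avg_shift]). Summation is Fejer's theorem,
    for the Riemann sums ([fejer_approx]). Correspondingly Q is replaced by its
    discrete version on a multiple of N points, fine enough for the norms above
    to be reached up to any eps > 0 ([one_variable_splitting]).

    Holomorphy means strict complex differentiability along each coordinate,
    which a convergent power series has at its centre
    ([power_series_strictly_diff]). Finite combinations of slices of f keep this
    property, and so operators in distinct variables can be composed. *)

Set Implicit Arguments.
Unset Strict Implicit.
Unset Printing Implicit Defensive.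

Local Open Scope complex_scope.
Local Open Scope ring_scope.

Local Notation normc := Normc.normc.

(** * Complex modulus and Fourier characters *)

Section ComplexExp.
Variable R : realType.
Implicit Types (z w a b : R[i]) (x y t : R) (k m : int).

Lemma normc_ge0 z : 0 <= normc z.
Proof. by case: z => a b; exact: sqrtr_ge0. Qed.

Lemma normc_real x : normc x%:C = `|x|.
Proof. by rewrite /normc /= expr0n addr0 sqrtr_sqr. Qed.

Lemma normc_nat (n : nat) : normc (n%:R : R[i]) = n%:R.
Proof. by rewrite -(rmorph_nat (real_complex R)) normc_real normr_nat. Qed.

Lemma normc_imag x : normc (0 +i* x) = `|x|.
Proof. by rewrite /normc /= expr0n add0r sqrtr_sqr. Qed.

Lemma normcB z w : normc (z - w) = normc (w - z).
Proof. by rewrite -opprB normcN. Qed.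

Lemma le_normc_sum (I : Type) (s : seq I) (P : pred I) (F : I -> R[i]) :
  normc (\sum_(i <- s | P i) F i) <= \sum_(i <- s | P i) normc (F i).
Proof.
elim/big_rec2: _ => [|i x z _ le_zx]; first by rewrite Normc.normc0.
by apply: le_trans (le_normcD _ _) _; rewrite lerD2l.
Qed.

Lemma normcX z (n : nat) : normc (z ^+ n) = normc z ^+ n.
Proof. by elim: n => [|n IH]; rewrite ?expr0 ?Normc.normc1 // !exprS Normc.normcM IH. Qed.

Lemma ler_Re_normc z : `|complex.Re z| <= normc z.
Proof.
case: z => a b /=; rewrite -sqrtr_sqr ler_sqrt ?addr_ge0 ?sqr_ge0 //.
by rewrite lerDl sqr_ge0.
Qed.

Lemma ler_Im_normc z : `|complex.Im z| <= normc z.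
Proof.
case: z => a b /=; rewrite -sqrtr_sqr ler_sqrt ?addr_ge0 ?sqr_ge0 //.
by rewrite lerDr sqr_ge0.
Qed.

Lemma normc_le_ReIm z : normc z <= `|complex.Re z| + `|complex.Im z|.
Proof.
have zE : z = (complex.Re z)%:C + (0 +i* complex.Im z).
  by case: z => a b; apply/eqP; rewrite eq_complex /= addr0 add0r !eqxx.
by rewrite {1}zE (le_trans (le_normcD _ _)) // normc_real normc_imag.
Qed.

Lemma ImD z w : complex.Im (z + w) = complex.Im z + complex.Im w.
Proof. by case: z w => [a b] [c d]. Qed.
Lemma ImB z w : complex.Im (z - w) = complex.Im z - complex.Im w.
Proof. by case: z w => [a b] [c d]. Qed.
Lemma ReB z w : complex.Re (z - w) = complex.Re z - complex.Re w.
Proof. by case: z w => [a b] [c d]. Qed.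

Lemma intrC m : (m%:~R : R[i]) = (m%:~R : R)%:C.
Proof. by rewrite rmorph_int. Qed.

Lemma cexpD z w : cexp (z + w) = cexp z * cexp w.
Proof.
case: z w => [a b] [c d]; rewrite /cexp /= expRD cosD sinD.
by apply/eqP; rewrite eq_complex /=; apply/andP; split; apply/eqP; ring.
Qed.

Lemma cexp0 : cexp (0 : R[i]) = 1.
Proof.
rewrite /cexp /= expR0 cos0 sin0.
by apply/eqP; rewrite eq_complex /=; apply/andP; split; apply/eqP; ring.
Qed.

Lemma normc_cexp z : normc (cexp z) = expR (complex.Re z).
Proof.
rewrite /cexp Normc.normcM normc_real ger0_norm ?expR_ge0 //.
by rewrite /normc /= cos2Dsin2 sqrtr1 mulr1.
Qed.

Lemma cexp_sum (I : Type) (s : seq I) (F : I -> R[i]) :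
  cexp (\sum_(i <- s) F i) = \prod_(i <- s) cexp (F i).
Proof. by elim/big_rec2: _ => [|i x z _ <-]; rewrite ?cexp0 ?cexpD. Qed.

Definition twopii : R[i] := 0 +i* (2 * pi).

Definition fchar k z : R[i] := cexp (twopii * (k%:~R * z)).

Lemma fcharDz k z w : fchar k (z + w) = fchar k z * fchar k w.
Proof. by rewrite /fchar !mulrDr cexpD. Qed.

Lemma fcharDk k m z : fchar (k + m) z = fchar k z * fchar m z.
Proof. by rewrite /fchar intrD mulrDl mulrDr cexpD. Qed.

Lemma fchar0k z : fchar 0 z = 1.
Proof. by rewrite /fchar mul0r mulr0 cexp0. Qed.

Lemma fchar0z k : fchar k 0 = 1.
Proof. by rewrite /fchar mulr0 mulr0 cexp0. Qed.

Lemma fcharNk k z : fchar (- k) z = fchar k (- z).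
Proof. by rewrite /fchar intrN mulrN mulNr. Qed.

Lemma fcharMN k z : fchar k z * fchar (- k) z = 1.
Proof. by rewrite -fcharDk subrr fchar0k. Qed.

Lemma normc_fchar k z : normc (fchar k z) = expR (- (2 * pi * k%:~R * complex.Im z)).
Proof.
rewrite /fchar normc_cexp intrC /twopii; case: z => a b /=; congr expR; ring.
Qed.

Lemma fchar_int k m : fchar k m%:~R = 1.
Proof.
suff fn (n : nat) : fchar k n%:R = 1.
  case: m => n; first exact: fn.
  rewrite NegzE intrN -fcharNk; have := fcharMN k n.+1%:R.
  by rewrite fn mul1r.
elim: n => [|n IH]; first exact: fchar0z.
rewrite -natr1 fcharDz IH mul1r.
suff c1 : fchar 1 1 = 1.
  have cn (n' : nat) : fchar n'%:Z 1 = 1.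
    by elim: n' => [|n' IH']; [exact: fchar0k | rewrite -addn1 PoszD fcharDk IH' c1 mul1r].
  case: k {IH} => n'; first exact: cn.
  rewrite NegzE; have := fcharMN n'.+1%:Z 1.
  by rewrite cn mul1r.
rewrite /fchar mul1r mulr1 /cexp /twopii /= expR0.
have -> : 2 * pi = pi *+ 2 :> R by rewrite mulr_natl.
rewrite cos2pi sin2pi.
by apply/eqP; rewrite eq_complex /=; apply/andP; split; apply/eqP; ring.
Qed.

Lemma fcharMk k m z : fchar (k * m) z = fchar k (m%:~R * z).
Proof. by rewrite /fchar intrM mulrA. Qed.

Lemma fcharX k (n : nat) z : fchar k z ^+ n = fchar (k * n%:Z) z.
Proof.
elim: n => [|n IH]; first by rewrite expr0 mulr0 fchar0k.
by rewrite exprS IH -fcharDk -addn1 PoszD mulrDr mulr1 addrC.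
Qed.

End ComplexExp.
Arguments fchar {R} k z : simpl never.

(** * Strict complex differentiability *)

Section StrictDifferentiability.
Variable R : realType.
Implicit Types (z w a b c : R[i]) (x y t : R) (k m : int) (g h : R[i] -> R[i]).

(** Both points of the difference quotient move: this form is preserved by sums
    and products, and it makes difference quotients uniform near z, as
    [uniform_CR] requires. *)
Definition strictly_diff_at g z d :=
  forall eps : R, 0 < eps -> exists2 delta : R, 0 < delta &
    forall a b, normc (a - z) < delta -> normc (b - z) < delta ->
      normc (g a - g b - d * (a - b)) <= eps * normc (a - b).

Definition strictly_diff g z := exists d, strictly_diff_at g z d.

Lemma strictly_diff_cst c z : strictly_diff (fun=> c) z.
Proof.
exists 0 => eps eps0; exists 1 => // a b _ _.
by rewrite subrr mul0r subrr Normc.normc0 mulr_ge0 ?normc_ge0 ?ltW.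
Qed.

Lemma strictly_diffD g h z : strictly_diff g z -> strictly_diff h z ->
  strictly_diff (fun w => g w + h w) z.
Proof.
move=> [d dg] [e eh]; exists (d + e) => eps eps0.
have eps2 : 0 < eps / 2 by rewrite divr_gt0.
have [dl dl0 Hg] := dg _ eps2; have [dm dm0 Hh] := eh _ eps2.
exists (Num.min dl dm); first by rewrite lt_min dl0.
move=> a b; rewrite !lt_min => /andP[a1 a2] /andP[b1 b2].
have -> : g a + h a - (g b + h b) - (d + e) * (a - b) =
  (g a - g b - d * (a - b)) + (h a - h b - e * (a - b)) by ring.
apply: le_trans (le_normcD _ _) _.
by have := Hg _ _ a1 b1; have := Hh _ _ a2 b2; lra.
Qed.

Lemma strictly_diff_cont g z : strictly_diff g z -> forall eps : R, 0 < eps ->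
  exists2 delta : R, 0 < delta &
    forall a, normc (a - z) < delta -> normc (g a - g z) <= eps.
Proof.
move=> [d dg] eps eps0.
have [dl dl0 Hg] := dg 1 ltr01.
have D0 : 0 < 1 + normc d by rewrite ltr_pwDl ?normc_ge0.
exists (Num.min dl (eps / (1 + normc d))); first by rewrite lt_min dl0 divr_gt0.
move=> a; rewrite lt_min => /andP[a1 a2].
have z1 : normc (z - z) < dl by rewrite subrr Normc.normc0.
have := Hg _ _ a1 z1; rewrite mul1r => H.
have -> : g a - g z = (g a - g z - d * (a - z)) + d * (a - z) by ring.
apply: le_trans (le_normcD _ _) _; rewrite Normc.normcM.
apply: (@le_trans _ _ ((1 + normc d) * normc (a - z))); first by rewrite mulrDl mul1r lerD2r.
by rewrite mulrC -ler_pdivlMr // ltW.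
Qed.

Lemma strictly_diffM g h z : strictly_diff g z -> strictly_diff h z ->
  strictly_diff (fun w => g w * h w) z.
Proof.
move=> sg sh; have [d dg] := sg; have [e eh] := sh.
exists (d * h z + g z * e) => eps eps0.
(* g a h a - g b h b = (g a - g b) h a + g b (h a - h b) *)
pose A := normc (h z) + 1; pose B := normc (g z) + 1.
pose D := normc d + 1; pose E := normc e + 1.
have A0 : 0 < A by rewrite ltr_wpDl ?normc_ge0.
have B0 : 0 < B by rewrite ltr_wpDl ?normc_ge0.
have D0 : 0 < D by rewrite ltr_wpDl ?normc_ge0.
have E0 : 0 < E by rewrite ltr_wpDl ?normc_ge0.
have e4 : 0 < eps / 4 by rewrite divr_gt0.
have [d1 d10 H1] := dg _ (divr_gt0 e4 A0).
have [d2 d20 H2] := eh _ (divr_gt0 e4 B0).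
have [d3 d30 H3] := strictly_diff_cont sh (divr_gt0 e4 D0).
have [d4 d40 H4] := strictly_diff_cont sg (divr_gt0 e4 E0).
have [d5 d50 H5] := strictly_diff_cont sh ltr01.
have [d6 d60 H6] := strictly_diff_cont sg ltr01.
exists (Num.min d1 (Num.min d2 (Num.min d3 (Num.min d4 (Num.min d5 d6))))).
  by rewrite !lt_min d10 d20 d30 d40 d50.
move=> a b; rewrite !lt_min => /and5P[a1 a2 a3 a4 /andP[a5 a6]].
move=> /and5P[b1 b2 b3 b4 /andP[b5 b6]].
have -> : g a * h a - g b * h b - (d * h z + g z * e) * (a - b) =
  ((g a - g b - d * (a - b)) * h a + (d * (h a - h z)) * (a - b)) +
  (g b * (h a - h b - e * (a - b)) + ((g b - g z) * e) * (a - b)) by ring.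
have ha : normc (h a) <= A.
  have -> : h a = h z + (h a - h z) by ring.
  by rewrite (le_trans (le_normcD _ _)) // lerD2l H5.
have gb : normc (g b) <= B.
  have -> : g b = g z + (g b - g z) by ring.
  by rewrite (le_trans (le_normcD _ _)) // lerD2l H6.
have T0 : 0 <= normc (a - b) by exact: normc_ge0.
have S1 : normc ((g a - g b - d * (a - b)) * h a) <= eps / 4 * normc (a - b).
  rewrite Normc.normcM; apply: (@le_trans _ _ (eps / 4 / A * normc (a - b) * A)).
    by rewrite ler_pM ?normc_ge0 // H1.
  by rewrite mulrAC divfK ?gt_eqF.
have S2 : normc (g b * (h a - h b - e * (a - b))) <= eps / 4 * normc (a - b).
  rewrite Normc.normcM; apply: (@le_trans _ _ (B * (eps / 4 / B * normc (a - b)))).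
    by rewrite ler_pM ?normc_ge0 // H2.
  by rewrite le_eqVlt; apply/orP; left; apply/eqP; field; rewrite gt_eqF.
have S3 : normc (d * (h a - h z) * (a - b)) <= eps / 4 * normc (a - b).
  rewrite !Normc.normcM ler_wpM2r //; apply: (@le_trans _ _ (D * (eps / 4 / D))).
    by rewrite ler_pM ?normc_ge0 // ?H3 // /D lerDl.
  by rewrite mulrC divfK ?gt_eqF.
have S4 : normc ((g b - g z) * e * (a - b)) <= eps / 4 * normc (a - b).
  rewrite !Normc.normcM ler_wpM2r //; apply: (@le_trans _ _ ((eps / 4 / E) * E)).
    by rewrite ler_pM ?normc_ge0 // ?H4 // /E lerDl.
  by rewrite divfK ?gt_eqF.
apply: le_trans (le_normcD _ _) _.
apply: le_trans (lerD (le_normcD _ _) (le_normcD _ _)) _.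
by lra.
Qed.

Lemma strictly_diffZ c g z : strictly_diff g z -> strictly_diff (fun w => c * g w) z.
Proof. by move=> sg; apply: strictly_diffM => //; exact: strictly_diff_cst. Qed.

Lemma strictly_diff_sum (I : eqType) (s : seq I) (F : I -> R[i] -> R[i]) z :
  (forall i, i \in s -> strictly_diff (F i) z) ->
  strictly_diff (fun w => \sum_(i <- s) F i w) z.
Proof.
elim: s => [|i s IH] H.
  have -> : (fun w => \sum_(i <- [::]) F i w) = (fun=> 0).
    by apply/funext => w; rewrite big_nil.
  exact: strictly_diff_cst.
have -> : (fun w => \sum_(j <- i :: s) F j w) =
          (fun w => F i w + \sum_(j <- s) F j w).
  by apply/funext => w; rewrite big_cons.
apply: strictly_diffD; first by apply: H; rewrite mem_head.
by apply: IH => j js; apply: H; rewrite inE js orbT.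
Qed.

Lemma derive_littleo (u : R -> R) (d : R) : is_derive (0 : R) (1 : R) u d ->
  forall eps : R, 0 < eps -> exists2 delta : R, 0 < delta &
  forall t, `|t| < delta -> `|u t - u 0 - d * t| <= eps * `|t|.
Proof.
move=> [du ud] eps eps0.
have := du; rewrite /derivable => /cvg_ex[l Hl].
have ld : l = d by rewrite -ud; apply/esym/cvg_lim.
rewrite {l}ld in Hl.
have /cvgrPdist_le/(_ _ eps0) := Hl.
move/nbhs_ballP => [dl /= dl0 H]; exists dl => // t tdl.
have [->|t0] := eqVneq t 0; first by rewrite subrr mulr0 subr0 normr0 mulr0.
have bt : ball (0 : R) dl t by rewrite -ball_normE /= sub0r normrN.
have := H t bt t0.
rewrite addr0 /GRing.scale /= mulr1 => K.
have -> : u t - u 0 - d * t = - (d - t^-1 * (u t - u 0)) * t.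
  by rewrite mulNr mulrBl mulrAC mulVf // mul1r opprB.
by rewrite normrM normrN ler_wpM2r.
Qed.

(** Combines the first-order expansions of exp, cos and sin at 0, the real and
    imaginary parts being treated separately. *)
Lemma cexp_littleo (eps : R) : 0 < eps -> exists2 delta : R, 0 < delta &
  forall w, normc w < delta -> normc (cexp w - 1 - w) <= eps * normc w.
Proof.
move=> eps0.
have [e e0 [ee1 ee]] : exists2 e : R, 0 < e & e <= 1 /\ e <= eps / 20.
  exists (Num.min (eps / 20) 1); first by rewrite lt_min ltr01 divr_gt0.
  by rewrite !ge_min !lexx orbT.
have [d1 d10 H1] := derive_littleo (is_derive_expR 0) e0.
have [d2 d20 H2] := derive_littleo (is_derive_sin 0) e0.
have [d3 d30 H3] := derive_littleo (is_derive_cos 0) e0.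
exists (Num.min (Num.min d1 e) (Num.min d2 d3)); first by rewrite !lt_min d10 d20 d30 e0.
move=> w; rewrite !lt_min => /andP[/andP[w1 we] /andP[w2 w3]].
have xw := ler_Re_normc w; have yw := ler_Im_normc w.
set x := complex.Re w in xw *; set y := complex.Im w in yw *.
have := H1 x (le_lt_trans xw w1); have := H2 y (le_lt_trans yw w2).
have := H3 y (le_lt_trans yw w3).
rewrite expR0 sin0 cos0 subr0 oppr0 mul0r subr0 !mul1r => Kc Ks Ke.
have n0 := normc_ge0 w.
apply: le_trans (normc_le_ReIm _) _.
rewrite !ReB !ImB -/x -/y /cexp -/x -/y /= !mul0r subr0 addr0.
pose p := expR x - 1 - x; pose q := cos y - 1; pose s := sin y - y.
have Ec : expR x * cos y - 1 - x = p + q * expR x by rewrite /p /q; ring.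
have Es : expR x * sin y - 0 - y = expR x * s + (p + x) * y by rewrite /p /s; ring.
rewrite Ec Es.
have ex0 := expR_ge0 x.
have P1 : `|p| <= e * normc w by apply: le_trans Ke _; rewrite ler_wpM2l // ltW.
have Q1 : `|q| <= e * normc w by apply: le_trans Kc _; rewrite ler_wpM2l // ltW.
have S1 : `|s| <= e * normc w by apply: le_trans Ks _; rewrite ler_wpM2l // ltW.
have w1' : normc w <= 1 by apply: le_trans (ltW we) _.
have en1 : e * normc w <= 1 by rewrite -[1]mulr1 ler_pM // ltW.
have ex3 : expR x <= 3.
  have -> : expR x = 1 + x + p by rewrite /p; ring.
  have := ler_norm p; have := ler_norm x; lra.
have L1 : `|q * expR x| <= 3 * (e * normc w).
  by rewrite normrM (ger0_norm ex0) mulrC ler_pM.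
have L2 : `|expR x * s| <= 3 * (e * normc w).
  by rewrite normrM (ger0_norm ex0) ler_pM.
have L3 : `|(p + x) * y| <= 2 * (e * normc w).
  rewrite normrM.
  apply: (@le_trans _ _ ((2 * normc w) * e)); last by rewrite -mulrA ler_wpM2l // mulrC.
  apply: ler_pM => //; last by apply: le_trans yw (ltW we).
  apply: le_trans (ler_normD _ _) _.
  have : e * normc w <= normc w by rewrite ler_piMl.
  lra.
have M1 := ler_normD p (q * expR x).
have M2 := ler_normD (expR x * s) ((p + x) * y).
have : e * normc w <= eps / 20 * normc w by rewrite ler_wpM2r.
have : 0 <= eps * normc w by rewrite mulr_ge0 // ltW.
lra.
Qed.

Lemma strictly_diff_fchar k z : strictly_diff (fchar k) z.
Proof.
pose c : R[i] := @twopii R * k%:~R.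
have fE w : fchar k w = cexp (c * w) by rewrite /fchar mulrA.
pose C := normc c + 1; pose F := normc (fchar k z) + 1.
have C0 : 0 < C by rewrite ltr_wpDl ?normc_ge0.
have F0 : 0 < F by rewrite ltr_wpDl ?normc_ge0.
have dev eps : 0 < eps -> exists2 delta : R, 0 < delta & forall w, normc w < delta ->
    normc (fchar k w - 1 - c * w) <= eps * normc w.
  move=> eps0; have [d d0 H] := cexp_littleo (divr_gt0 eps0 C0).
  exists (d / C); first exact: divr_gt0.
  move=> w wd; rewrite fE.
  have cw : normc (c * w) <= C * normc w.
    by rewrite Normc.normcM ler_wpM2r ?normc_ge0 // lerDl.
  apply: le_trans (H _ _) _.
    by apply: le_lt_trans cw _; rewrite mulrC -ltr_pdivlMr.
  rewrite -mulrA ler_wpM2l ?(ltW eps0) // ler_pdivrMl //.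
have cont eps : 0 < eps -> exists2 delta : R, 0 < delta & forall w, normc w < delta ->
    normc (fchar k w - 1) <= eps.
  move=> eps0; have [d d0 H] := dev _ ltr01.
  have C20 : 0 < 1 + C by lra.
  exists (Num.min d (eps / (1 + C))); first by rewrite lt_min d0 divr_gt0.
  move=> w; rewrite lt_min => /andP[w1 w2]; have := H _ w1; rewrite mul1r => K.
  have -> : fchar k w - 1 = (fchar k w - 1 - c * w) + c * w by ring.
  apply: le_trans (le_normcD _ _) _; rewrite Normc.normcM.
  have : normc c * normc w <= C * normc w by rewrite ler_wpM2r ?normc_ge0 // lerDl.
  move: w2; rewrite ltr_pdivlMr // mulrDr mulr1 [normc w * C]mulrC.
  lra.
exists (fchar k z * c) => eps eps0.
have e2 : 0 < eps / 2 by rewrite divr_gt0.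
have [d1 d10 H1] := dev _ (divr_gt0 e2 (mulr_gt0 F0 (ltr0n R 2))).
have [d2 d20 H2] := cont _ (divr_gt0 e2 (mulr_gt0 F0 C0)).
have [d3 d30 H3] := cont _ ltr01.
exists (Num.min (d1 / 2) (Num.min d2 d3)); first by rewrite !lt_min d20 d30 divr_gt0.
move=> a b; rewrite !lt_min => /and3P[a1 a2 a3] /and3P[b1 b2 b3].
have n0 := normc_ge0 (a - b).
have ab : normc (a - b) < d1.
  have -> : a - b = (a - z) + (z - b) by ring.
  apply: le_lt_trans (le_normcD _ _) _; rewrite [normc (z - b)]normcB; lra.
have -> : fchar k a - fchar k b - fchar k z * c * (a - b) =
   fchar k b * (fchar k (a - b) - 1 - c * (a - b)) +
   fchar k z * ((fchar k (b - z) - 1) * (c * (a - b))).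
  have -> : fchar k a = fchar k b * fchar k (a - b).
    by rewrite -fcharDz; congr fchar; ring.
  have -> : fchar k b = fchar k z * fchar k (b - z).
    by rewrite -fcharDz; congr fchar; ring.
  ring.
apply: le_trans (le_normcD _ _) _.
rewrite (Normc.normcM (fchar k b)) (Normc.normcM (fchar k z)).
rewrite (Normc.normcM (_ - 1)) (Normc.normcM c).
have fb : normc (fchar k b) <= F * 2.
  have -> : fchar k b = fchar k z * (fchar k (b - z) - 1 + 1).
    by rewrite subrK -fcharDz; congr fchar; ring.
  rewrite Normc.normcM ler_pM ?normc_ge0 ?lerDl //.
  apply: le_trans (le_normcD _ _) _; rewrite Normc.normc1.
  by have := H3 _ b3; lra.
have S1 : normc (fchar k b) * normc (fchar k (a - b) - 1 - c * (a - b)) <=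
   eps / 2 * normc (a - b).
  apply: (@le_trans _ _ (F * 2 * (eps / 2 / (F * 2) * normc (a - b)))).
    by rewrite ler_pM ?normc_ge0 // H1.
  by rewrite le_eqVlt; apply/orP; left; apply/eqP; field; rewrite gt_eqF.
have S2 : normc (fchar k z) * (normc (fchar k (b - z) - 1) * (normc c * normc (a - b)))
   <= eps / 2 * normc (a - b).
  apply: (@le_trans _ _ (F * ((eps / 2 / (F * C)) * (C * normc (a - b))))).
    rewrite ler_pM ?mulr_ge0 ?normc_ge0 ?lerDl //.
    by rewrite ler_pM ?mulr_ge0 ?normc_ge0 ?H2 // ler_wpM2r // lerDl.
  by rewrite le_eqVlt; apply/orP; left; apply/eqP; field; rewrite !gt_eqF.
apply: le_trans (lerD S1 S2) _.
by rewrite -mulrDl -splitr.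
Qed.

End StrictDifferentiability.

(** * Averages over horizontal lines *)

Section Shift.
Variable R : realType.
Implicit Types (z w a b c : R[i]) (x y : R) (k m : int) (g : R[i] -> R[i]).

Definition in_strip (h : R) z := `|complex.Im z| < h.

Definition holo (h : R) g :=
  (forall z, in_strip h z -> g (z + 1) = g z) /\
  (forall z, in_strip h z -> strictly_diff g z).

Lemma complexD (x y t u : R) : (x +i* y) + (t +i* u) = (x + t) +i* (y + u) :> R[i].
Proof. by []. Qed.

Lemma complexB (x y t u : R) : (x +i* y) - (t +i* u) = (x - t) +i* (y - u) :> R[i].
Proof. by []. Qed.

(** Near a point where g is strictly differentiable with derivative d, both
    increments are d times the displacement up to o(t), and the displacements
    differ by the factor i eta. Compactness of [0, 1] x [-r, r] makes the
    estimate uniform. The factor eta in [-1, 1] lets a vertical step be any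
    fraction of the horizontal one, so that every height can be reached. *)
Lemma uniform_CR h g r (eps : R) : holo h g -> r < h -> 0 < eps ->
  exists2 d0 : R, 0 < d0 & forall x y (eta d : R),
    0 <= x <= 1 -> `|y| <= r -> `|eta| <= 1 -> 0 < d < d0 ->
    normc (g (x +i* (y + eta * d)) - g (x +i* y)
      - (0 +i* eta) * (g ((x + d) +i* y) - g (x +i* y))) <= eps * d.
Proof.
move=> [_ sg] rh eps0.
pose P (d : R) (p : R * R) := forall eta : R, `|eta| <= 1 -> 0 < d ->
  normc (g (p.1 +i* (p.2 + eta * d)) - g (p.1 +i* p.2)
      - (0 +i* eta) * (g ((p.1 + d) +i* p.2) - g (p.1 +i* p.2))) <= eps * d.
have cK : compact (`[0, 1]%classic `*` `[- r, r]%classic : set (R * R)).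
  by apply: compact_setX; exact: segment_compact.
have /compact_near_coveringP/(_ R (at_right (0 : R)) P _) := cK.
case=> [|d0 /= d00 H]; last first.
  exists d0 => // x y eta d x01 yr eta1 /andP[dgt dlt].
  apply: (H d _ _ (x, y)) => //=; first by rewrite sub0r normrN gtr0_norm.
  by split; rewrite /= in_itv //= -ler_norml.
move=> [x0 y0] [/= _ ]; rewrite in_itv /= -ler_norml => y0r.
have [d dP] := sg (x0 +i* y0) (le_lt_trans y0r rh).
have e2 : 0 < eps / 2 by rewrite divr_gt0.
have [dl dl0 Hd] := dP _ e2.
have dl4 : 0 < dl / 4 by rewrite divr_gt0.
exists (ball x0 (dl / 4) `*` ball y0 (dl / 4), [set t | 0 < t < dl / 4])%classic => /=.
  split; first by exists (ball x0 (dl / 4), ball y0 (dl / 4))%classic => //=; split; exact: nbhsx_ballx.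
  near=> t => /=; apply/andP; split; first by near: t; exact: nbhs_right_gt.
  by near: t; exact: nbhs_right_lt.
move=> [[x y] t] [[/= bx by'] /andP[t0 t4]] eta eta1 _ /=.
have X : normc ((x - x0) +i* (y - y0)) < dl / 2.
  apply: le_lt_trans (normc_le_ReIm _) _ => /=.
  move: bx by'; rewrite /ball /= (distrC x0) (distrC y0); lra.
have tn : `|t| = t by rewrite gtr0_norm.
have eT : `|eta * t| <= t by rewrite normrM tn ler_piMl // ltW.
have pz : normc ((x +i* y) - (x0 +i* y0)) < dl by rewrite complexB; lra.
have p1 : normc ((x +i* (y + eta * t)) - (x0 +i* y0)) < dl.
  have -> : (x +i* (y + eta * t)) - (x0 +i* y0) = ((x - x0) +i* (y - y0)) + (0 +i* (eta * t)).
    by rewrite complexB complexD addr0; congr (_ +i* _); ring.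
  by apply: le_lt_trans (le_normcD _ _) _; rewrite normc_imag; lra.
have p2 : normc (((x + t) +i* y) - (x0 +i* y0)) < dl.
  have -> : ((x + t) +i* y) - (x0 +i* y0) = ((x - x0) +i* (y - y0)) + t%:C.
    by rewrite complexB complexD addr0; congr (_ +i* _); ring.
  by apply: le_lt_trans (le_normcD _ _) _; rewrite normc_real; lra.
have D1 : (x +i* (y + eta * t)) - (x +i* y) = (0 +i* eta) * t%:C.
  by rewrite complexB; apply/eqP; rewrite eq_complex /=; apply/andP; split; apply/eqP; ring.
have D2 : ((x + t) +i* y) - (x +i* y) = t%:C.
  by rewrite complexB; apply/eqP; rewrite eq_complex /=; apply/andP; split; apply/eqP; ring.
have := Hd _ _ p1 pz; rewrite D1 Normc.normcM normc_imag normc_real tn.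
have := Hd _ _ p2 pz; rewrite D2 normc_real tn.
set A := g (x +i* (y + eta * t)); set B := g (x +i* y); set D := g ((x + t) +i* y).
move=> K2 K1.
have -> : A - B - (0 +i* eta) * (D - B) = (A - B - d * ((0 +i* eta) * t%:C))
   - (0 +i* eta) * (D - B - d * t%:C) by ring.
apply: le_trans (le_normcD _ _) _; rewrite normcN (Normc.normcM (0 +i* eta)) normc_imag.
have : `|eta| * normc (D - B - d * t%:C) <= 1 * (eps / 2 * t).
  by rewrite ler_pM // normc_ge0.
have : eps / 2 * (`|eta| * t) <= eps / 2 * t.
  by rewrite ler_wpM2l ?(ltW e2) // ler_piMl // ltW.
lra.
Unshelve. all: by end_near.
Qed.

Definition line_avg (L : nat) g y : R[i] :=
  L%:R^-1 * \sum_(j < L) g ((j%:R / L%:R) +i* y).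

(** The height y is reached in m L vertical steps of size (y / m) / L, with m
    fixed. In each step the horizontal differences telescope to 0 by
    periodicity, so that the average changes by at most eps / (m L). *)
Lemma line_avg_shift h g r (eps : R) : holo h g -> r < h -> 0 < eps ->
  exists L0 : nat, forall L y, (L0 <= L)%N -> `|y| <= r ->
    normc (line_avg L g y - line_avg L g 0) <= eps.
Proof.
move=> hg rh eps0.
have [per _] := hg.
pose m := (Num.truncn r).+1.
have rm : r < m%:R by apply: truncnS_gt.
have m0 : 0 < m%:R :> R by rewrite ltr0n.
have [d0 d00 H] := uniform_CR hg rh (divr_gt0 eps0 m0).
exists (Num.truncn d0^-1).+1 => L y L0L yr.
have L0 : (0 < L)%N by apply: leq_trans L0L.
have Lr : 0 < L%:R :> R by rewrite ltr0n.
have dL : L%:R^-1 < d0.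
  rewrite -[d0]invrK ltf_pV2 ?posrE ?invr_gt0 //.
  by apply: lt_le_trans (truncnS_gt _) _; rewrite ler_nat.
pose eta := y / m%:R; pose Y (t : nat) := t%:R * (eta * L%:R^-1).
have etam : `|eta| * m%:R = `|y| by rewrite /eta normrM normfV (gtr0_norm m0) divfK ?gt_eqF.
have eta1 : `|eta| <= 1.
  by rewrite -(ler_pM2r m0) etam mul1r (le_trans yr) // ltW.
have YmL : Y (m * L)%N = y.
  by rewrite /Y natrM /eta; field; rewrite !gt_eqF.
have Yr t : (t <= m * L)%N -> `|Y t| <= r.
  move=> tm; apply: le_trans yr; rewrite -YmL /Y !normrM !normr_nat.
  by rewrite ler_wpM2r ?mulr_ge0 // ler_nat.
have step t : (t < m * L)%N -> normc (line_avg L g (Y t.+1) - line_avg L g (Y t)) <= eps / m%:R / L%:R.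
  move=> tm; have tr := Yr t (ltnW tm).
  pose q (j : nat) := g ((j%:R / L%:R) +i* Y t).
  have tel : \sum_(j < L) (q j.+1 - q j) = 0.
    rewrite -(big_mkord xpredT (fun j => q j.+1 - q j)) telescope_sumr //.
    rewrite /q divff ?gt_eqF // mul0r -(per (0 +i* Y t)); last exact: le_lt_trans rh.
    have -> : (0 +i* Y t) + 1 = 1 +i* Y t :> R[i].
      by apply/eqP; rewrite eq_complex /= add0r addr0 !eqxx.
    by rewrite subrr.
  have -> : line_avg L g (Y t.+1) - line_avg L g (Y t) = L%:R^-1 * \sum_(j < L)
     (g ((j%:R / L%:R) +i* (Y t + eta * L%:R^-1)) - g ((j%:R / L%:R) +i* Y t)
      - (0 +i* eta) * (g ((j%:R / L%:R + L%:R^-1) +i* Y t) - g ((j%:R / L%:R) +i* Y t))).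
    rewrite /line_avg -mulrBr -sumrB [in RHS]sumrB -mulr_sumr.
    have -> : \sum_(j < L) (g ((j%:R / L%:R + L%:R^-1) +i* Y t) - g ((j%:R / L%:R) +i* Y t)) = 0.
      rewrite -[RHS]tel; apply: eq_bigr => j _; rewrite /q; congr (g (_ +i* _) - _).
      by rewrite -natr1 mulrDl mul1r.
    rewrite mulr0 subr0; congr (_ * _); apply: eq_bigr => j _.
    by congr (g (_ +i* _) - _); rewrite /Y -natr1 mulrDl mul1r.
  rewrite Normc.normcM Normc.normcV normc_nat mulrC ler_wpM2r ?invr_ge0 //.
  apply: le_trans (le_normc_sum _ _ _) _.
  apply: (@le_trans _ _ (\sum_(j < L) (eps / m%:R * L%:R^-1))).
    apply: ler_sum => j _; apply: H => //.
    - by rewrite divr_ge0 //= ler_pdivrMr // mul1r ler_nat ltnW.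
    - by rewrite invr_gt0 Lr.
  by rewrite sumr_const card_ord -[_ *+ L]mulr_natr divfK ?gt_eqF.
suff S t : (t <= m * L)%N -> normc (line_avg L g (Y t) - line_avg L g 0) <= t%:R * (eps / m%:R / L%:R).
  have := S _ (leqnn _); rewrite YmL => /le_trans; apply.
  by rewrite le_eqVlt; apply/orP; left; apply/eqP; rewrite natrM; field; rewrite !gt_eqF.
elim: t => [|t IH] tm; first by rewrite /Y mul0r subrr Normc.normc0 mul0r.
have -> : line_avg L g (Y t.+1) - line_avg L g 0 =
  (line_avg L g (Y t.+1) - line_avg L g (Y t)) + (line_avg L g (Y t) - line_avg L g 0) by ring.
apply: le_trans (le_normcD _ _) _; rewrite -natr1 mulrDl mul1r [leRHS]addrC.
by rewrite lerD ?step ?IH // ltnW.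
Qed.

End Shift.

(** * Discrete Fourier coefficients and their decay *)

Section Fejer.
Variable R : realType.
Implicit Types (z w a b c : R[i]) (x y t : R) (k m : int) (g : R[i] -> R[i]).

Lemma holo_int h g z k : holo h g -> in_strip h z -> g (z + k%:~R) = g z.
Proof.
move=> [per _].
have nat_per (n : nat) w : in_strip h w -> g (w + n%:R) = g w.
  elim: n w => [|n IH] w hw; first by rewrite addr0.
  rewrite -natr1 addrA per ?IH // /in_strip.
  rewrite ImD; suff -> : complex.Im (n%:R : R[i]) = 0 by rewrite addr0.
  by rewrite -(rmorph_nat (real_complex R)).
have imk : complex.Im (k%:~R : R[i]) = 0 by rewrite intrC.
case: k imk => n imk hz; first exact: nat_per.
rewrite -(@nat_per n.+1 (z + _)); last by rewrite /in_strip ImD imk addr0.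
by rewrite NegzE intrN subrK.
Qed.

Lemma holoM_fchar h g k : holo h g -> holo h (fun z => g z * fchar k z).
Proof.
move=> [per sg]; split=> z hz.
  by rewrite per // fcharDz (fchar_int R k 1) mulr1.
by apply: strictly_diffM; [exact: sg | exact: strictly_diff_fchar].
Qed.

Definition grid_coef (L : nat) g k : R[i] := line_avg L (fun z => g z * fchar (- k) z) 0.

Definition decay (h : R) k : R := expR (- (2 * pi * h * (absz k)%:R)).

Lemma absz_sgr k : (absz k)%:R = (sgz k)%:~R * k%:~R :> R.
Proof.
rewrite -intrM; have -> : sgz k * k = (absz k)%:Z by rewrite abszEsg.
by [].
Qed.

Lemma continuous_left_eps (u : R -> R) (h eps : R) : {for h, continuous u} ->
  0 < h -> 0 < eps -> exists2 r, 0 < r < h & u r <= u h + eps.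
Proof.
move=> uc h0 eps0; have /cvgrPdist_le/(_ _ eps0) := uc.
move/nbhs_ballP => [dl /= dl0 H].
pose m := Num.min dl h / 2.
have m0 : 0 < Num.min dl h by rewrite lt_min dl0.
have md : Num.min dl h <= dl by rewrite ge_min lexx.
have mh : Num.min dl h <= h by rewrite ge_min lexx orbT.
exists (h - m); first by apply/andP; split; rewrite /m; lra.
have bh : ball h dl (h - m).
  by rewrite -ball_normE /= opprB addrC subrK /m gtr0_norm; lra.
have := H _ bh; rewrite /= distrC => K.
by have := ler_norm (u (h - m) - u h); lra.
Qed.

(** The line of summation is moved to height - sgn(k) r, with r < h close to h;
    there the character e_(-k) has modulus exp (- 2 pi |k| r). *)
Lemma grid_coef_bound h g M (eps : R) k : holo h g -> 0 < h ->
  (forall z, in_strip h z -> normc (g z) <= M) -> 0 < eps ->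
  exists L0 : nat, forall L, (L0 <= L)%N ->
    normc (grid_coef L g k) <= M * decay h k + eps.
Proof.
move=> hg h0 gM eps0.
have e2 : 0 < eps / 2 by rewrite divr_gt0.
have M0 : 0 <= M.
  by apply: le_trans (gM 0 _); rewrite ?normc_ge0 // /in_strip /= normr0.
have [r /andP[r0 rh] Hr] : exists2 r, 0 < r < h & M * decay r k <= M * decay h k + eps / 2.
  apply: (@continuous_left_eps (fun r => M * decay r k)) => //.
  apply: cvgM; first exact: cvg_cst.
  apply: continuous_comp; last exact: continuous_expR.
  apply: cvgN; apply: cvgM; last exact: cvg_cst.
  by apply: cvgM; [exact: cvg_cst | exact: cvg_id].
have hgk := holoM_fchar (- k) hg.
have [L0 HL] := line_avg_shift hgk rh e2.
exists (maxn 1 L0) => L; rewrite geq_max => /andP[L1 LL0].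
pose y := - ((sgz k)%:~R * r).
have yr : `|y| <= r.
  rewrite /y normrN normrM (gtr0_norm r0) ler_piMl ?(ltW r0) //.
  by rewrite intr_sg normr_sg; case: (_ != 0).
have -> : grid_coef L g k = line_avg L (fun z => g z * fchar (- k) z) y
   - (line_avg L (fun z => g z * fchar (- k) z) y - line_avg L (fun z => g z * fchar (- k) z) 0).
  by rewrite subKr.
apply: le_trans (le_normcD _ _) _; rewrite normcN.
have := HL _ _ LL0 yr.
suff : normc (line_avg L (fun z => g z * fchar (- k) z) y) <= M * decay r k by lra.
rewrite /line_avg Normc.normcM Normc.normcV normc_nat mulrC ler_pdivrMr ?ltr0n //.
apply: le_trans (le_normc_sum _ _ _) _.
apply: (@le_trans _ _ (\sum_(j < L) (M * decay r k))); last by rewrite sumr_const card_ord mulr_natr.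
apply: ler_sum => j _; rewrite Normc.normcM normc_fchar ler_pM ?normc_ge0 ?expR_ge0 //.
  by apply: gM; rewrite /in_strip /=; apply: le_lt_trans yr rh.
rewrite /decay ler_expR /= absz_sgr intrN /y.
by rewrite le_eqVlt; apply/orP; left; apply/eqP; ring.
Qed.

Lemma round_half t : exists k, `|t - k%:~R| <= 1 / 2.
Proof.
have /andP[f1 f2] := floor_itv (t + 1 / 2).
exists (Num.floor (t + 1 / 2)); move: f1 f2; rewrite intrD ler_norml.
by move=> f1 f2; apply/andP; split; lra.
Qed.

Lemma fchar_real k x :
  fchar k x%:C = cos (2 * pi * k%:~R * x) +i* sin (2 * pi * k%:~R * x).
Proof.
rewrite /fchar intrC -rmorphM /cexp /twopii /= mul0r mulr0 subr0 expR0.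
have -> : 2 * pi * (k%:~R * x) = 2 * pi * k%:~R * x by ring.
by rewrite mul1r mul0r add0r.
Qed.

(** cos is decreasing on [0, pi], so that 1 - cos (2 pi x) is bounded below away
    from the integers. *)
Lemma fchar_far (d : R) : 0 < d -> exists2 kap : R, 0 < kap &
  forall x, d <= `|x| -> `|x| <= 1 / 2 -> kap <= normc (fchar 1 x%:C - 1).
Proof.
move=> d0; have p0 := pi_gt0 R.
pose d' := Num.min d (1 / 2).
have d'0 : 0 < d' by rewrite lt_min d0; lra.
have d'd : d' <= d by rewrite ge_min lexx.
have d'2 : d' <= 1 / 2 by rewrite ge_min lexx orbT.
have in0pi x : 0 <= x -> x <= 1 / 2 -> 2 * pi * x \in `[0, pi].
  move=> x0 x2; rewrite in_itv /=; apply/andP; split.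
    by rewrite !mulr_ge0 // ltW.
  have : pi * x <= pi * (1 / 2) by rewrite ler_wpM2l // ltW.
  lra.
exists (1 - cos (2 * pi * d')).
  have z0 : 0 \in `[0, pi : R] by rewrite in_itv /= lexx ltW.
  have dd : 2 * pi * d' \in `[0, pi : R] by apply: in0pi => //; exact: ltW.
  by rewrite subr_gt0 -[ltRHS](@cos0 R) (ltr_cos z0 dd) !mulr_gt0.
move=> x dx x2; rewrite fchar_real mulr1.
apply: le_trans (ler_Re_normc _); rewrite ReB /=.
have cE : cos (2 * pi * x) = cos (2 * pi * `|x|).
  by rewrite -cos_norm !normrM (gtr0_norm p0) normr_nat.
have : cos (2 * pi * `|x|) <= cos (2 * pi * d').
  have [->//|ne] := eqVneq `|x| d'.
  have xx : 2 * pi * `|x| \in `[0, pi : R] by apply: in0pi.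
  have dd : 2 * pi * d' \in `[0, pi : R] by apply: in0pi => //; exact: ltW.
  apply: ltW; rewrite (ltr_cos dd xx).
  by rewrite ltr_pM2l ?mulr_gt0 // lt_neqAle eq_sym ne (le_trans d'd).
rewrite -cE => K.
have := ler_norm (- (cos (2 * pi * x) - 1)); rewrite normrN; lra.
Qed.

Lemma fchar_eq1 t : fchar 1 t%:C = 1 -> exists k, t = k%:~R.
Proof.
move=> ft; have [k kt] := round_half t; exists k.
have [->//|ne] := eqVneq t k%:~R.
have d0 : 0 < `|t - k%:~R| by rewrite normr_gt0 subr_eq0.
have [kap kap0 /(_ _ (lexx _) kt)] := fchar_far d0.
suff -> : fchar 1 (t - k%:~R)%:C = 1.
  by rewrite subrr Normc.normc0 leNgt kap0.
rewrite rmorphB /= fcharDz ft mul1r -intrC -intrN; exact: fchar_int.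
Qed.

(** The terms are the powers of an L-th root of unity, which is 1 exactly when L
    divides k. *)
Lemma sum_fchar_grid (L : nat) k : (0 < L)%N ->
  \sum_(j < L) fchar k (j%:R / L%:R : R)%:C = if (L%:Z %| k)%Z then L%:R else 0.
Proof.
move=> L0; have Lr : (L%:R : R) != 0 by rewrite pnatr_eq0 -lt0n.
pose om := fchar k ((L%:R^-1 : R)%:C).
have E (j : nat) : fchar k (j%:R / L%:R : R)%:C = om ^+ j.
  by rewrite /om fcharX fcharMk rmorphM /= rmorph_nat.
have omL : om ^+ L = 1.
  by rewrite -E divff // -[1%:C]/((1%:~R : R[i])) fchar_int.
case: ifPn => [/dvdzP[q ->]|nd].
  rewrite (eq_bigr (fun=> 1)) ?sumr_const ?card_ord // => j _.
  have -> : (j%:R / L%:R : R)%:C = j%:R / L%:R :> R[i] by rewrite rmorphM /= fmorphV !rmorph_nat.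
  rewrite fcharMk -pmulrn mulrCA divff ?mulr1; last by rewrite pnatr_eq0 -lt0n.
  exact: (fchar_int R q j).
have om1 : om != 1.
  apply: contra nd => /eqP; rewrite /om -[k]mul1r fcharMk intrC -rmorphM => /fchar_eq1[q qE].
  apply/dvdzP; exists q; apply: (@intr_inj R); rewrite mul1r intrM -qE.
  by rewrite divfK.
have : (om - 1) * (\sum_(j < L) om ^+ j) = 0 by rewrite -subrX1 omL subrr.
move/eqP; rewrite mulf_eq0 subr_eq0 (negPf om1) /= => /eqP S0.
rewrite -[RHS]S0.
by apply: eq_bigr => j _; rewrite E.
Qed.

End Fejer.

(** * Fejer summation and the bound for functionals *)

Lemma sum_ord_cst (V : nzRingType) (n : nat) (c : V) : \sum_(i < n) c = c * n%:R.
Proof. by rewrite sumr_const card_ord mulr_natr. Qed.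

Section FejerApprox.
Variable R : realType.
Implicit Types (z w a b c : R[i]) (x y t : R) (k m : int) (g : R[i] -> R[i]).

Lemma conj_fchar_real k x : (fchar k x%:C)^*%C = fchar (- k) x%:C.
Proof. by rewrite !fchar_real intrN !mulrN !mulNr cosN sinN. Qed.

(** The squared modulus makes positivity evident; [fejerE] gives the
    trigonometric polynomial. *)
Definition fejer (K : nat) x : R :=
  K%:R^-1 * normc (\sum_(p < K) fchar p x%:C) ^+ 2.

Lemma fejer_ge0 K x : 0 <= fejer K x.
Proof. by rewrite mulr_ge0 ?invr_ge0 ?exprn_ge0 ?normc_ge0. Qed.

Lemma fejerE K x : (fejer K x)%:C =
  K%:R^-1 * \sum_(p < K) \sum_(q < K) fchar (q%:Z - p%:Z) x%:C.
Proof.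
rewrite /fejer rmorphM fmorphV rmorph_nat rmorphXn /=; congr (_ * _).
have -> : (normc (\sum_(p < K) fchar p x%:C))%:C = `|\sum_(p < K) fchar p x%:C| by [].
rewrite sqr_normc rmorph_sum mulrC mulr_suml; apply: eq_bigr => p _.
rewrite mulr_sumr; apply: eq_bigr => q _.
by rewrite fcharDk mulrC -conj_fchar_real.
Qed.

(** Summing the geometric series turns the kernel into
    |e_K(x) - 1|^2 / (K |e_1(x) - 1|^2). *)
Lemma fejer_far K x (kap : R) : (0 < K)%N -> 0 < kap ->
  kap <= normc (fchar 1 x%:C - 1) -> fejer K x <= 4 / (K%:R * kap ^+ 2).
Proof.
move=> K0 kap0 far; have Kr : 0 < K%:R :> R by rewrite ltr0n.
set S := \sum_(p < K) fchar p x%:C.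
have S2 : normc S * normc (fchar 1 x%:C - 1) <= 2.
  rewrite -Normc.normcM mulrC.
  have -> : (fchar 1 x%:C - 1) * S = fchar K%:Z x%:C - 1.
    rewrite -[K%:Z]mul1r -fcharX subrX1; congr (_ * _).
    by apply: eq_bigr => j _; rewrite fcharX mul1r.
  apply: le_trans (le_normcD _ _) _; rewrite normcN Normc.normc1 normc_fchar /=.
  by rewrite mulr0 oppr0 expR0.
have S1 : normc S <= 2 / kap.
  by rewrite ler_pdivlMr //; apply: le_trans S2; rewrite ler_wpM2l ?normc_ge0.
have -> : 4 / (K%:R * kap ^+ 2) = K%:R^-1 * (2 / kap) ^+ 2.
  by field; rewrite !gt_eqF.
rewrite ler_wpM2l ?invr_ge0 ?(ltW Kr) //.
by apply: lerXn2r => //; rewrite nnegrE ?normc_ge0 // divr_ge0 // ltW.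
Qed.

(** The dichotomy behind Fejer's theorem: by periodicity g(z + t) is close to
    g(z) as soon as t is close to an integer, and otherwise the kernel is
    small. *)
Lemma near_or_far h g z (eps : R) : holo h g -> in_strip h z -> 0 < eps ->
  exists2 kap : R, 0 < kap & forall t,
    kap <= normc (fchar 1 t%:C - 1) \/ normc (g (z + t%:C) - g z) <= eps.
Proof.
move=> hg hz eps0; have [_ sg] := hg.
have [d d0 H] := strictly_diff_cont (sg _ hz) eps0.
have [kap kap0 far] := fchar_far d0; exists kap => // t.
have [k kt] := round_half t.
have [dt|td] := leP d `|t - k%:~R|.
  left; apply: le_trans (far _ dt kt) _.
  suff -> : fchar 1 (t - k%:~R)%:C = fchar 1 t%:C by [].
  by rewrite rmorphB /= fcharDz -intrC -intrN fchar_int mulr1.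
right.
have -> : g (z + t%:C) = g (z + (t - k%:~R)%:C).
  rewrite -[in LHS](subrK k%:~R t) rmorphD /= addrA -intrC (holo_int _ hg) //.
  by rewrite /in_strip ImD addr0.
by apply: H; rewrite addrC addKr normc_real.
Qed.

Lemma eventually_all (T : eqType) (s : seq T) (P : T -> nat -> Prop) :
  (forall i, i \in s -> exists L0 : nat, forall L, (L0 <= L)%N -> P i L) ->
  exists L0 : nat, forall L, (L0 <= L)%N -> forall i, i \in s -> P i L.
Proof.
elim: s => [|i s IH] H; first by exists 0%N.
have [L1 H1] := H i (mem_head _ _).
have [|L2 H2] := IH; first by move=> j js; apply: H; rewrite inE js orbT.
exists (maxn L1 L2) => L; rewrite geq_max => /andP[l1 l2] j.
by rewrite inE => /orP[/eqP->|]; [exact: H1 | exact: H2].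
Qed.

(** The Cesaro mean of the Fourier series, with the frequencies written as
    differences p - q so that the weight of k is K - |k|. *)
Definition fejer_sum (L K : nat) g z : R[i] :=
  K%:R^-1 * \sum_(p < K) \sum_(q < K)
    grid_coef L g (p%:Z - q%:Z) * fchar (p%:Z - q%:Z) z.

(** On the horizontal line through z the Cesaro mean is the average of g against
    a translate of the Fejer kernel. That kernel is nonnegative, has mean 1 on a
    grid of at least K points, and is O(1/K) away from the integers. *)
Lemma fejer_line h g M z (eps : R) : holo h g ->
  (forall z, in_strip h z -> normc (g z) <= M) -> in_strip h z -> 0 < eps ->
  exists K0 : nat, forall K, (K0 <= K)%N -> forall L, (K <= L)%N -> (0 < K)%N ->
  normc (K%:R^-1 * (\sum_(p < K) \sum_(q < K)
     line_avg L (fun w => g w * fchar (- (p%:Z - q%:Z)) w) (complex.Im z) * fchar (p%:Z - q%:Z) z)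
    - g z) <= eps.
Proof.
move=> hg gM hz eps0.
have e2 : 0 < eps / 2 by rewrite divr_gt0.
have [kap kap0 NF] := near_or_far hg hz e2.
have M0 : 0 <= M by apply: le_trans (gM _ hz); exact: normc_ge0.
pose A := 8 * M / kap ^+ 2 / (eps / 2).
exists (Num.truncn A).+1 => K KA L KL K0.
have Kr : 0 < K%:R :> R by rewrite ltr0n.
have L0 : (0 < L)%N by apply: leq_trans KL.
have Lr : 0 < L%:R :> R by rewrite ltr0n.
have AK : 2 * M * (4 / (K%:R * kap ^+ 2)) <= eps / 2.
  have : A <= K%:R by rewrite (le_trans (ltW (truncnS_gt _))) // ler_nat.
  rewrite /A ler_pdivrMr // => H.
  have -> : 2 * M * (4 / (K%:R * kap ^+ 2)) = 8 * M / kap ^+ 2 / K%:R.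
    by field; rewrite !gt_eqF.
  by rewrite ler_pdivrMr // (le_trans H) // mulrC.
pose t (j : nat) : R := j%:R / L%:R - complex.Re z.
have zt (j : nat) : (j%:R / L%:R) +i* complex.Im z = z + (t j)%:C.
  by rewrite /t; case: z {hz NF t} => x y /=; rewrite complexD addr0 addrC subrK.
have E1 : K%:R^-1 * (\sum_(p < K) \sum_(q < K)
     line_avg L (fun w => g w * fchar (- (p%:Z - q%:Z)) w) (complex.Im z) * fchar (p%:Z - q%:Z) z)
   = L%:R^-1 * \sum_(j < L) (fejer K (t j))%:C * g (z + (t j)%:C).
  rewrite (eq_bigr (fun p : 'I_K => \sum_(q < K) \sum_(j < L)
     L%:R^-1 * (fchar (q%:Z - p%:Z) (t j)%:C * g (z + (t j)%:C)))); last first.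
    move=> p _; apply: eq_bigr => q _.
    rewrite /line_avg -mulrA -mulr_sumr; congr (_ * _).
    rewrite big_distrl /=; apply: eq_bigr => j _; rewrite zt opprB.
    rewrite fcharDz -(opprB q%:Z) -mulrA mulrC; congr (_ * _).
    by rewrite mulrAC fcharMN mul1r.
  rewrite (eq_bigr (fun p : 'I_K => \sum_(j < L) \sum_(q < K)
     L%:R^-1 * (fchar (q%:Z - p%:Z) (t j)%:C * g (z + (t j)%:C)))); last first.
    by move=> p _; rewrite exchange_big.
  rewrite exchange_big /= !mulr_sumr; apply: eq_bigr => j _.
  rewrite fejerE mulr_sumr mulr_sumr mulr_suml mulr_sumr; apply: eq_bigr => p _.
  rewrite !mulr_sumr mulr_suml mulr_sumr; apply: eq_bigr => q _.
  ring.
have E2 : L%:R^-1 * \sum_(j < L) (fejer K (t j))%:C = 1 :> R[i].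
  rewrite (eq_bigr (fun j : 'I_L => \sum_(p < K) \sum_(q < K)
     K%:R^-1 * (fchar (q%:Z - p%:Z) (- complex.Re z)%:C * fchar (q%:Z - p%:Z) (j%:R / L%:R : R)%:C))); last first.
    move=> j _; rewrite fejerE !mulr_sumr; apply: eq_bigr => p _.
    rewrite !mulr_sumr; apply: eq_bigr => q _.
    rewrite -fcharDz; congr (_ * fchar _ _).
    by rewrite complexD addr0 addrC.
  rewrite exchange_big /= (eq_bigr (fun p : 'I_K => K%:R^-1 * L%:R)); last first.
    move=> p _; rewrite exchange_big /= (bigD1 p) //= [X in _ + X]big1 ?addr0.
      rewrite -mulr_sumr -mulr_sumr subrr sum_fchar_grid // dvdz0 fchar0k mul1r //.
    move=> q qp; rewrite -mulr_sumr -mulr_sumr sum_fchar_grid //.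
    case: ifPn; last by rewrite !mulr0.
    rewrite dvdzE /= => /dvdn_leq dl; exfalso.
    have qp' : (q : nat) != p by rewrite val_eqE.
    have := ltn_ord p; have := ltn_ord q.
    have : (0 < `|(q%:Z - p%:Z)%R|)%N by rewrite absz_gt0 subr_eq0 eqz_nat.
    by move/dl; lia.
  rewrite sum_ord_cst.
  by field; rewrite !pnatr_eq0 -!lt0n K0 L0.
have -> : K%:R^-1 * (\sum_(p < K) \sum_(q < K)
     line_avg L (fun w => g w * fchar (- (p%:Z - q%:Z)) w) (complex.Im z) * fchar (p%:Z - q%:Z) z)
    - g z = L%:R^-1 * \sum_(j < L) (fejer K (t j))%:C * (g (z + (t j)%:C) - g z).
  have gE : g z = L%:R^-1 * ((\sum_(j < L) (fejer K (t j))%:C) * g z) by rewrite mulrA E2 mul1r.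
  rewrite E1 [X in _ - X]gE -mulrBr mulr_suml -sumrB.
  by congr (_ * _); apply: eq_bigr => j _; rewrite mulrBr.
rewrite Normc.normcM Normc.normcV normc_nat.
apply: le_trans (ler_wpM2l _ (le_normc_sum _ _ _)) _; first by rewrite invr_ge0 ltW.
have bnd j : normc ((fejer K (t j))%:C * (g (z + (t j)%:C) - g z)) <= eps / 2 * fejer K (t j) + eps / 2.
  rewrite Normc.normcM normc_real (ger0_norm (fejer_ge0 _ _)).
  have [far|near] := NF (t j).
    apply: ler_wpDl; first by rewrite mulr_ge0 ?fejer_ge0 // ltW.
    apply: le_trans AK; rewrite mulrC ler_pM ?normc_ge0 ?fejer_ge0 //; last exact: fejer_far.
    apply: le_trans (le_normcD _ _) _; rewrite normcN.
    have := gM _ hz; have : normc (g (z + (t j)%:C)) <= M.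
      by apply: gM; rewrite /in_strip ImD addr0.
    lra.
  apply: ler_wpDr; first exact: ltW.
  by rewrite mulrC ler_wpM2r ?fejer_ge0.
apply: (@le_trans _ _ (L%:R^-1 * \sum_(j < L) (eps / 2 * fejer K (t j) + eps / 2))).
  by rewrite ler_wpM2l ?invr_ge0 ?(ltW Lr) //; apply: ler_sum => j _; exact: bnd.
have E2r : L%:R^-1 * \sum_(j < L) fejer K (t j) = 1 :> R.
  apply: (@complexI R); rewrite rmorphM fmorphV rmorph_nat rmorph_sum /= E2 //.
rewrite big_split /= -mulr_sumr mulrDr mulrCA E2r sumr_const card_ord.
have -> : L%:R^-1 * (eps / 2 *+ L) = eps / 2.
  by rewrite -(mulr_natr (eps / 2)) mulrCA mulVf ?mulr1 // gt_eqF.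
by rewrite mulr1 -splitr.
Qed.

(** The coefficients are averages on the real line; [line_avg_shift] moves each
    of the finitely many that occur to the height of z, at the cost of taking L
    large after K. *)
Lemma fejer_approx h g M z (eps : R) : holo h g ->
  (forall z, in_strip h z -> normc (g z) <= M) -> in_strip h z -> 0 < eps ->
  exists K0 : nat, forall K, (K0 <= K)%N -> (0 < K)%N ->
  exists L0 : nat, forall L, (L0 <= L)%N ->
    normc (fejer_sum L K g z - g z) <= eps.
Proof.
move=> hg gM hz eps0.
have e2 : 0 < eps / 2 by rewrite divr_gt0.
have [K0 HK] := fejer_line hg gM hz e2.
exists K0 => K K0K Kgt0.
have Kr : 0 < K%:R :> R by rewrite ltr0n.
pose r := `|complex.Im z|.
pose V (k : int) := normc (fchar k z).
pose e' (k : int) := eps / 2 / (K%:R * (V k + 1)).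
have V0 k : 0 < V k + 1 by rewrite ltr_wpDl ?normc_ge0.
have e'0 k : 0 < e' k by rewrite /e' !divr_gt0 // mulr_gt0.
pose G k := fun w => g w * fchar (- k) w.
have [L1 H1] := @eventually_all _ [seq p%:Z - q%:Z | p <- iota 0 K, q <- iota 0 K]
  (fun k L => normc (line_avg L (G k) (complex.Im z) - line_avg L (G k) 0) <= e' k)
  (fun k _ => let: ex_intro L0 HL := line_avg_shift (holoM_fchar (- k) hg) hz (e'0 k) in
     ex_intro _ L0 (fun L LL => HL L (complex.Im z) LL (lexx _))).
exists (maxn K L1) => L; rewrite geq_max => /andP[KL LL1].
set F := K%:R^-1 * (\sum_(p < K) \sum_(q < K)
     line_avg L (fun w => g w * fchar (- (p%:Z - q%:Z)) w) (complex.Im z) * fchar (p%:Z - q%:Z) z).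
have -> : fejer_sum L K g z - g z = (fejer_sum L K g z - F) + (F - g z) by ring.
apply: le_trans (le_normcD _ _) _.
have : normc (F - g z) <= eps / 2 by exact: HK.
suff : normc (fejer_sum L K g z - F) <= eps / 2 by lra.
rewrite /fejer_sum /F -mulrBr -sumrB Normc.normcM Normc.normcV normc_nat.
rewrite mulrC ler_pdivrMr //.
apply: le_trans (le_normc_sum _ _ _) _.
apply: (@le_trans _ _ (\sum_(p < K) eps / 2)); last by rewrite sum_ord_cst.
apply: ler_sum => p _; rewrite -sumrB.
apply: le_trans (le_normc_sum _ _ _) _.
apply: (@le_trans _ _ (\sum_(q < K) eps / 2 / K%:R)); last first.
  by rewrite sum_ord_cst divfK ?gt_eqF.
apply: ler_sum => q _; rewrite -mulrBl Normc.normcM normcB.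
set k := p%:Z - q%:Z.
have ks : k \in [seq p%:Z - q%:Z | p <- iota 0 K, q <- iota 0 K].
  by apply/allpairsP; exists (p : nat, q : nat); rewrite !mem_iota /= !ltn_ord.
have := H1 L LL1 k ks; rewrite /G /grid_coef -/(V k) => Hk.
apply: le_trans (ler_pM (normc_ge0 _) (normc_ge0 _) Hk (_ : V k <= V k + 1)) _; first by rewrite lerDl.
rewrite /e' le_eqVlt; apply/orP; left; apply/eqP; field.
by rewrite !gt_eqF.
Qed.

(** A finitely supported functional is the list of its weights and points. *)
Definition fapply (S : seq (R[i] * R[i])) g : R[i] := \sum_(p <- S) p.1 * g p.2.

(** At the finitely many points of the functional, g is replaced by a Cesaro
    mean, whose coefficients are bounded by M times the decay rate up to a small
    error. The order of choices is eps, then K, then L. *)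
Lemma functional_bound h (S : seq (R[i] * R[i])) (B : R) : 0 < h ->
  (forall p, p \in S -> in_strip h p.2) ->
  (forall s : seq int, uniq s ->
     \sum_(m <- s) decay h m * normc (fapply S (fchar m)) <= B) ->
  forall g M, holo h g -> (forall z, in_strip h z -> normc (g z) <= M) ->
  normc (fapply S g) <= M * B.
Proof.
move=> h0 hS HB g M hg gM; apply/ler_addgt0Pr => eps eps0.
have M0 : 0 <= M.
  by apply: le_trans (gM 0 _); rewrite ?normc_ge0 // /in_strip /= normr0.
have e2 : 0 < eps / 2 by rewrite divr_gt0.
pose W := \sum_(p <- S) normc p.1.
have W0 : 0 <= W by apply: sumr_ge0 => p _; exact: normc_ge0.
have W1 : 0 < W + 1 by rewrite ltr_wpDl.
have [K0 HK] := @eventually_all _ S (fun p K => (0 < K)%N -> exists L0 : nat, forall L, (L0 <= L)%N ->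
    normc (fejer_sum L K g p.2 - g p.2) <= eps / 2 / (W + 1))
  (fun p pS => fejer_approx hg gM (hS p pS) (divr_gt0 e2 W1)).
pose K := maxn 1 K0.
have Kgt0 : (0 < K)%N by rewrite leq_max.
have Kr : 0 < K%:R :> R by rewrite ltr0n.
have KK0 : (K0 <= K)%N by rewrite leq_max leqnn orbT.
have [L1 H1] := @eventually_all _ S _ (fun p pS => HK K KK0 p pS Kgt0).
pose V (k : int) := normc (fapply S (fchar k)).
pose VS := \sum_(q < K) \sum_(p < K) V (p%:Z - q%:Z).
have VS0 : 0 <= VS by apply: sumr_ge0 => q _; apply: sumr_ge0 => p _; exact: normc_ge0.
have VS1 : 0 < VS + 1 by rewrite ltr_wpDl.
(* the tolerance on each coefficient depends on K through VS *)
have [L2 H2] := @eventually_all _ [seq p%:Z - q%:Z | p <- iota 0 K, q <- iota 0 K]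
  (fun k L => normc (grid_coef L g k) <= M * decay h k + eps / 2 / (VS + 1))
  (fun k _ => grid_coef_bound k hg h0 gM (divr_gt0 e2 VS1)).
pose L := maxn L1 L2.
have {}H1 p : p \in S -> normc (fejer_sum L K g p.2 - g p.2) <= eps / 2 / (W + 1).
  by apply: H1; rewrite leq_max leqnn.
have {}H2 (p q : 'I_K) : normc (grid_coef L g (p%:Z - q%:Z)) <=
    M * decay h (p%:Z - q%:Z) + eps / 2 / (VS + 1).
  apply: H2; first by rewrite leq_max leqnn orbT.
  by apply/allpairsP; exists (p : nat, q : nat); rewrite !mem_iota /= !ltn_ord.
have -> : fapply S g = fapply S (fejer_sum L K g) - \sum_(p <- S) p.1 * (fejer_sum L K g p.2 - g p.2).
  by rewrite /fapply -sumrB; apply: eq_bigr => p _; ring.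
apply: le_trans (le_normcD _ _) _; rewrite normcN.
have T1 : normc (\sum_(p <- S) p.1 * (fejer_sum L K g p.2 - g p.2)) <= eps / 2.
  apply: le_trans (le_normc_sum _ _ _) _.
  apply: (@le_trans _ _ (W * (eps / 2 / (W + 1)))).
    rewrite /W mulr_suml big_seq [leRHS]big_seq; apply: ler_sum => p pS.
    by rewrite Normc.normcM ler_wpM2l ?normc_ge0 ?H1.
  rewrite mulrA ler_pdivrMr // mulrC ler_wpM2l ?(ltW e2) //.
  by rewrite lerDl.
suff T2 : normc (fapply S (fejer_sum L K g)) <= M * B + eps / 2 by lra.
have -> : fapply S (fejer_sum L K g) = K%:R^-1 * \sum_(q < K) \sum_(p < K)
    grid_coef L g (p%:Z - q%:Z) * fapply S (fchar (p%:Z - q%:Z)).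
  rewrite /fapply /fejer_sum exchange_big /=.
  under eq_bigr do rewrite mulrCA mulr_sumr.
  rewrite -mulr_sumr exchange_big /=; congr (_ * _); apply: eq_bigr => p _.
  under eq_bigr do rewrite mulr_sumr.
  rewrite exchange_big /=; apply: eq_bigr => q _.
  by rewrite mulr_sumr; apply: eq_bigr => u _; rewrite mulrCA.
rewrite Normc.normcM Normc.normcV normc_nat mulrC ler_pdivrMr //.
apply: le_trans (le_normc_sum _ _ _) _.
apply: (@le_trans _ _ (\sum_(q < K) (M * B + eps / 2 / (VS + 1) * \sum_(p < K) V (p%:Z - q%:Z)))).
  apply: ler_sum => q _.
  apply: le_trans (le_normc_sum _ _ _) _.
  apply: (@le_trans _ _ (\sum_(p < K) (M * (decay h (p%:Z - q%:Z) * V (p%:Z - q%:Z)) +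
      eps / 2 / (VS + 1) * V (p%:Z - q%:Z)))).
    apply: ler_sum => p _; rewrite Normc.normcM mulrA -mulrDl.
    by rewrite ler_wpM2r ?normc_ge0 ?H2.
  rewrite big_split /= -!mulr_sumr lerD2r ler_wpM2l //.
  have us : uniq [seq p%:Z - q%:Z | p <- iota 0 K].
    by rewrite map_inj_uniq ?iota_uniq // => u v /addIr[].
  have := HB _ us; rewrite big_map.
  by rewrite -[X in iota 0 X]subn0 -/(index_iota 0 K) big_mkord.
rewrite big_split /= sum_ord_cst -mulr_sumr -/VS mulrDl lerD2l.
apply: (@le_trans _ _ (eps / 2)); last by rewrite ler_peMr ?(ltW e2) // ler1n.
rewrite mulrAC ler_pdivrMr // ler_wpM2l ?(ltW e2) //.
by rewrite lerDl.
Qed.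

End FejerApprox.

(** * Sums over residue classes of frequencies *)

Lemma ler_sum_subset (R : realType) (T : eqType) (s t : seq T) (F : T -> R) :
  (forall x, 0 <= F x) -> uniq s -> {subset s <= t} ->
  \sum_(x <- s) F x <= \sum_(x <- t) F x.
Proof.
move=> F0; elim: s t => [|x s IH] t /=; first by move=> _ _; rewrite big_nil sumr_ge0.
move=> /andP[xs us] st; have xt : x \in t by apply: st; rewrite mem_head.
rewrite big_cons (big_rem x xt) /= lerD2l; apply: IH => // y ys.
by apply: rem_mem; [apply: contraNneq xs => <- | apply: st; rewrite inE ys orbT].
Qed.

Lemma sum_iota (V : nmodType) (n : nat) (F : nat -> V) :
  \sum_(u <- iota 0 n) F u = \sum_(u < n) F u.
Proof. by rewrite -(big_mkord xpredT) /index_iota subn0. Qed.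

Section Counting.
Variable R : realType.
Implicit Types (h x y t : R) (k m : int).

Lemma geo_sum_le y (n : nat) : 0 <= y < 1 -> \sum_(u < n) y ^+ u <= (1 - y)^-1.
Proof.
move=> /andP[y0 y1]; rewrite -[leRHS]mul1r ler_pdivlMr ?subr_gt0 //.
have := subrX1 y n => E.
have -> : (\sum_(u < n) y ^+ u) * (1 - y) = 1 - y ^+ n.
  by rewrite -[RHS]opprB E -mulNr opprB mulrC.
by rewrite gerBl exprn_ge0.
Qed.

(** The closed form of the sum of [decay h m] over all m congruent to k mod L,
    valid for |k| <= L: two geometric series of ratio exp (- 2 pi h L), starting
    at k and at the nearest term of the opposite sign. *)
Definition residue_sum h (L : nat) k : R :=
  (decay h k + expR (- (2 * pi * h * (L%:R - (absz k)%:R)))) /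
  (1 - expR (- (2 * pi * h * L%:R))).

Lemma decayN h k : decay h (- k) = decay h k :> R.
Proof. by rewrite /decay abszN. Qed.

Lemma expR_decay_lt1 h (L : nat) : 0 < h -> (0 < L)%N ->
  0 <= expR (- (2 * pi * h * L%:R)) < 1.
Proof.
move=> h0 L0; rewrite expR_ge0 /= expR_lt1 oppr_lt0 !mulr_gt0 ?pi_gt0 ?ltr0n //.
Qed.

(** A finite set of terms of the progression is contained in
    {n + L u} and {n - L (u + 1)} with u < T, for some T. *)
Lemma sum_progression_nat h (L n : nat) (s : seq int) : 0 < h -> (0 < L)%N ->
  (n <= L)%N -> uniq s ->
  \sum_(m <- s | (L%:Z %| m - n%:Z)%Z) decay h m <= residue_sum h L n.
Proof.
move=> h0 L0 nL us; set y : R := expR (- (2 * pi * h * L%:R)).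
have y01 : 0 <= y < 1 by exact: expR_decay_lt1.
have [T HT] : exists T, forall m, m \in s -> (absz m + n < T)%N.
  exists ((\sum_(m <- s) absz m) + n).+1 => m ms.
  by rewrite (big_rem m ms) /= ltnS leq_add2r leq_addr.
rewrite -big_filter.
apply: (@le_trans _ _ (\sum_(m <- [seq n%:Z + L%:Z * u%:Z | u <- iota 0 T] ++
   [seq n%:Z - L%:Z * u.+1%:Z | u <- iota 0 T]) decay h m)).
  apply: ler_sum_subset; [by move=> m; exact: expR_ge0 | exact: filter_uniq |].
  move=> m; rewrite mem_filter => /andP[/dvdzP[q mq] ms].
  have mT := HT m ms.
  have qT : (absz q <= absz m + n)%N.
    have : (absz q <= absz (q * L%:Z)%R)%N by rewrite abszM absz_nat leq_pmulr.
    rewrite -mq; lia.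
  rewrite mem_cat; apply/orP; case: (leP 0 q) => q0.
    left; apply/mapP; exists (absz q); first by rewrite mem_iota; lia.
    by rewrite gez0_abs // mulrC -mq addrC subrK.
  right; apply/mapP; exists (absz q).-1; first by rewrite mem_iota; lia.
  rewrite prednK ?absz_gt0 ?lt_eqF //.
  have -> : (absz q)%:Z = - q by rewrite ltz0_abs.
  by rewrite mulrN opprK mulrC -mq addrC subrK.
rewrite big_cat /= !big_map /residue_sum mulrDl lerD //.
  rewrite sum_iota.
  apply: (@le_trans _ _ (\sum_(u < T) decay h n * y ^+ u)); last first.
    by rewrite -mulr_sumr ler_wpM2l ?expR_ge0 // geo_sum_le.
  rewrite le_eqVlt; apply/orP; left; apply/eqP; apply: eq_bigr => u _.
  rewrite /decay /y -expRM_natl -expRD; congr expR.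
  have -> : absz (n%:Z + L%:Z * u%:Z) = (n + L * u)%N by [].
  by rewrite natrD natrM; ring.
rewrite sum_iota.
apply: (@le_trans _ _ (\sum_(u < T) expR (- (2 * pi * h * (L%:R - n%:R))) * y ^+ u)); last first.
  by rewrite -mulr_sumr ler_wpM2l ?expR_ge0 // geo_sum_le.
rewrite le_eqVlt; apply/orP; left; apply/eqP; apply: eq_bigr => u _.
rewrite /decay /y -expRM_natl -expRD; congr expR.
have -> : absz (n%:Z - L%:Z * u.+1%:Z)%R = (L - n + L * u)%N by nia.
by rewrite natrD natrM natrB //; ring.
Qed.

Lemma sum_progression h (L : nat) k (s : seq int) : 0 < h -> (0 < L)%N ->
  (absz k <= L)%N -> uniq s ->
  \sum_(m <- s | (L%:Z %| m - k)%Z) decay h m <= residue_sum h L k.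
Proof.
case: k => n h0 L0 nL us; first exact: sum_progression_nat.
have us' : uniq [seq - m | m <- s] by rewrite map_inj_uniq // ; exact: oppr_inj.
have := sum_progression_nat h0 L0 nL us'; rewrite big_map /residue_sum.
rewrite {1}/decay absz_nat -/(decay h (Negz n)).
congr (_ <= _); apply: eq_big => [m|m _]; last exact: decayN.
by rewrite NegzE abszN absz_nat opprK -opprD !dvdzE abszN.
Qed.

Definition freq (N i : nat) : int := i%:Z - (N./2)%:Z.

(** The representative of m mod N in the window, which is where sampling on N
    points sends the frequency m. *)
Definition window_rep (N : nat) m : int := freq N (absz ((m + (N./2)%:Z) %% N)%Z).

Lemma window_repP N m : (0 < N)%N -> exists2 i :
  'I_N, window_rep N m = freq N i & (N%:Z %| m - freq N i)%Z.
Proof.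
move=> N0; have N0' : N%:Z != 0 by rewrite eqz_nat -lt0n.
pose q := ((m + (N./2)%:Z) %% N)%Z.
have q0 : 0 <= q by exact: modz_ge0.
have qN : q < N%:Z by apply: ltz_pmod; rewrite ltz_nat.
have iN : (absz q < N)%N by lia.
exists (Ordinal iN) => //=.
rewrite /freq gez0_abs // opprB addrA.
have -> : m + (N./2)%:Z - q = ((m + (N./2)%:Z) %/ N%:Z)%Z * N%:Z.
  by rewrite {1}(divz_eq (m + (N./2)%:Z) N%:Z) addrK.
by rewrite dvdz_mull.
Qed.

Lemma freq_inj_mod N (i j : nat) : (i < N)%N -> (j < N)%N ->
  (N%:Z %| freq N i - freq N j)%Z -> i = j.
Proof.
move=> iN jN; rewrite /freq opprB addrA subrK dvdzE absz_nat => d.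
apply/eqP; rewrite -(eqz_nat i j) -subr_eq0 -absz_eq0.
by apply/negPn/negP; rewrite -lt0n => /dvdn_leq/(_ d); lia.
Qed.

Lemma window_rep_unique N m (i : 'I_N) : (N%:Z %| m - freq N i)%Z ->
  window_rep N m = freq N i.
Proof.
move=> d; have N0 : (0 < N)%N by apply: leq_trans (ltn_ord i).
have [j -> dj] := window_repP m N0; congr freq.
apply: (freq_inj_mod (ltn_ord j) (ltn_ord i)).
have -> : freq N j - freq N i = (m - freq N i) - (m - freq N j) by ring.
by rewrite rpredB.
Qed.

Lemma window_rep_freq N (i : 'I_N) : window_rep N (freq N i) = freq N i.
Proof. by apply: window_rep_unique; rewrite subrr dvdz0. Qed.

Lemma freq_le N (i : nat) : (i < N)%N -> (absz (freq N i) <= N)%N.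
Proof. by move=> iN; rewrite /freq; lia. Qed.

Definition weight (rho : R) k : R := expR (2 * pi * rho * (absz k)%:R).

(** A bound that holds for every finite set of frequencies holds for the union
    of the given one with the window, whose contribution can be subtracted. *)
Lemma sum_off_window N (s : seq int) (F : int -> R) (B : R) :
  (forall m, 0 <= F m) -> (forall s, uniq s -> \sum_(m <- s) F m <= B) ->
  uniq s -> \sum_(m <- s | m \notin [seq freq N i | i <- iota 0 N]) F m <=
    B - \sum_(i < N) F (freq N i).
Proof.
move=> F0 FB us; set I := [seq freq N i | i <- iota 0 N].
have uI : uniq I by rewrite map_inj_uniq ?iota_uniq // => i j /addIr[].
have := FB (I ++ [seq m <- s | m \notin I]).
rewrite cat_uniq uI filter_uniq // andbT /=.
have -> : ~~ has (mem I) [seq m <- s | m \notin I].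
  by apply/hasPn => m; rewrite mem_filter => /andP[].
move=> /(_ isT); rewrite big_cat /= big_filter {1}/I big_map.
rewrite sum_iota; lra.
Qed.

(** For L = N this bounds the norm of the grid operator; for L a large multiple
    of N, that of the discrete version of the truncation to the window. *)
Definition alias_sum (L N : nat) (rho h : R) : R :=
  \sum_(i < N) weight rho (freq N i) * residue_sum h L (freq N i).

Lemma sum_residue h rho (L N : nat) (s : seq int) : 0 < h -> (0 < N)%N -> (N %| L)%N ->
  (0 < L)%N -> uniq s ->
  \sum_(m <- s | (L%:Z %| m - window_rep N m)%Z) decay h m * weight rho (window_rep N m) <= alias_sum L N rho h.
Proof.
move=> h0 N0 NL L0 us.
apply: (@le_trans _ _ (\sum_(i < N) \sum_(m <- s | (L%:Z %| m - freq N i)%Z)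
    decay h m * weight rho (freq N i))); last first.
  apply: ler_sum => i _; rewrite -mulr_suml mulrC ler_wpM2l ?expR_ge0 //.
  apply: sum_progression => //; apply: leq_trans (dvdn_leq L0 NL); exact: freq_le.
rewrite (exchange_big_dep xpredT) //= big_mkcond; apply: ler_sum => m _.
have nn (i : 'I_N) : 0 <= decay h m * weight rho (freq N i) by rewrite mulr_ge0 ?expR_ge0.
case: ifPn => [Lm|_]; last exact: sumr_ge0.
have [i ri di] := window_repP m N0.
by rewrite (bigD1 i) /= -ri // lerDl sumr_ge0.
Qed.

Lemma sum_powers (x : R) (n : nat) : x != 1 ->
  \sum_(u < n) x ^+ u = (1 - x ^+ n) / (1 - x).
Proof.
move=> x1; have d : 1 - x != 0 by rewrite subr_eq0 eq_sym.
apply: (mulIf d); rewrite divfK // -[RHS]opprB subrX1; ring.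
Qed.

(** nu_N is the sum of a two-sided geometric progression over the window; the
    factor mu_N accounts for the window being symmetric only for odd N. *)
Lemma sum_freq_nu N (delta : R) : delta != 0 ->
  \sum_(i < N) expR (- (2 * pi * delta * (absz (freq N i))%:R)) = nu N delta.
Proof.
move=> d0; have p0 : (0 : R) < pi := pi_gt0 R.
pose x : R := expR (- (2 * pi * delta)).
have x0 : 0 < x by exact: expR_gt0.
have x1 : x != 1.
  rewrite /x -[1]expR0 (inj_eq (@expR_inj R)) oppr_eq0 !mulf_neq0 //.
  by rewrite gt_eqF.
have xX (n : nat) : expR (- (2 * pi * delta * n%:R)) = x ^+ n.
  by rewrite /x -expRM_natl; congr expR; ring.
have Ex : expR (2 * pi * delta) = x^-1 by rewrite /x expRN invrK.
have E1 : 1 - x != 0 by rewrite subr_eq0 eq_sym.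
have E2 : 1 + x != 0 by rewrite gt_eqF // addr_gt0.
pose M := N./2; pose K := (N - M)%N.
have NMK : N = (M + K)%N by rewrite /K /M; lia.
have -> : \sum_(i < N) expR (- (2 * pi * delta * (absz (freq N i))%:R)) =
   \sum_(i < M) x ^+ (i.+1) + \sum_(i < K) x ^+ i.
  rewrite -(big_mkord xpredT (fun i => expR (- (2 * pi * delta * (absz (freq N i))%:R)))).
  rewrite (big_cat_nat _ (n := M)) //=; last by rewrite NMK leq_addr.
  congr (_ + _).
    rewrite big_mkord (reindex_inj rev_ord_inj) /=; apply: eq_bigr => i _.
    rewrite xX /freq -/M; congr (_ ^+ _); have := ltn_ord i; lia.
  rewrite -{1}[M]add0n big_addn -/K big_mkord; apply: eq_bigr => i _.
  by rewrite xX /freq -/M; congr (_ ^+ _); lia.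
rewrite (eq_bigr (fun i : 'I_M => x * x ^+ i)); last by move=> i _; rewrite exprS.
rewrite -mulr_sumr !sum_powers // /nu Ex /mu.
have [oN|eN] := boolP (odd N).
  have KM : K = M.+1 by rewrite /K /M; lia.
  have -> : expR (- (pi * delta * N%:R)) = x ^+ M / expR (pi * delta).
    rewrite -xX -expRN -expRD; congr expR.
    have -> : N%:R = 1 + 2 * M%:R :> R by rewrite NMK KM !natrD -natr1; ring.
    ring.
  have h0 : expR (pi * delta) != 0 by rewrite gt_eqF ?expR_gt0.
  by rewrite KM Ex exprS; field; rewrite h0 E2 mulN1r E1 gt_eqF.
have KM : K = M by rewrite /K /M; lia.
have -> : expR (- (pi * delta * N%:R)) = x ^+ M.
  rewrite -xX; congr expR; rewrite NMK KM natrD; ring.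
by rewrite KM; field; rewrite mulN1r E1 gt_eqF.
Qed.

Lemma sum_weight_decay h rho N : rho != h ->
  \sum_(i < N) decay h (freq N i) * weight rho (freq N i) = nu N (h - rho).
Proof.
move=> ne; rewrite -sum_freq_nu; last by rewrite subr_eq0 eq_sym.
by apply: eq_bigr => i _; rewrite /decay /weight -expRD; congr expR; ring.
Qed.

(** The hyperbolic cotangent of pi delta. *)
Definition coth (delta : R) : R :=
  (expR (2 * pi * delta) + 1) / (expR (2 * pi * delta) - 1).

(** With L = 1 there is a single residue class, and its closed form is the
    hyperbolic cotangent. *)
Lemma sum_all h rho (s : seq int) : rho < h -> uniq s ->
  \sum_(m <- s) decay h m * weight rho m <= coth (h - rho).
Proof.
move=> rh us; have d0 : 0 < h - rho by rewrite subr_gt0.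
have := @sum_progression_nat (h - rho) 1 0 s d0 isT isT us.
under eq_bigl do rewrite dvd1z.
have -> : \sum_(m <- s) decay (h - rho) m = \sum_(m <- s) decay h m * weight rho m.
  by apply: eq_bigr => m _; rewrite /decay /weight -expRD; congr expR; ring.
suff -> : residue_sum (h - rho) 1 0 = coth (h - rho) by [].
rewrite /residue_sum /decay /coth /= subr0 !mulr1 mulr0 oppr0 expR0.
have E : expR (2 * pi * (h - rho)) - 1 != 0.
  by rewrite subr_eq0 gt_eqF // expR_gt1 !mulr_gt0 // pi_gt0.
by rewrite expRN; field; rewrite E /= gt_eqF ?expR_gt0.
Qed.

Lemma alias_sumE N rho h : 0 <= rho -> rho < h -> (0 < N)%N ->
  alias_sum N N rho h = (nu N (h - rho) +
     expR (- (2 * pi * h * N%:R)) * nu N (- h - rho)) / (1 - expR (- (2 * pi * h * N%:R))).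
Proof.
move=> r0 rh N0.
have d1 : h - rho != 0 by rewrite gt_eqF // subr_gt0.
have d2 : - h - rho != 0 by rewrite lt_eqF //; lra.
rewrite -(sum_freq_nu N d1) -(sum_freq_nu N d2).
rewrite /alias_sum mulr_sumr -big_split /= mulr_suml; apply: eq_bigr => i _.
rewrite /residue_sum mulrA; congr (_ / _); rewrite mulrDr /weight /decay -!expRD.
by congr (expR _ + expR _); ring.
Qed.

(** For k in the window, every other term of its class mod L = p N has modulus at
    least L - N, so that the excess over nu_N is O(exp (- 2 pi h (p - 1))). *)
Lemma alias_sum_lim N rho h (eps : R) : 0 <= rho -> rho < h -> (0 < N)%N -> 0 < eps ->
  exists2 p : nat, (0 < p)%N & alias_sum (p * N) N rho h <= nu N (h - rho) + eps.
Proof.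
move=> r0 rh N0 eps0; have h0 : 0 < h by apply: le_lt_trans rh.
pose x : R := expR (- (2 * pi * h)).
have p0 : (0 : R) < pi := pi_gt0 R.
have x0 : 0 < x by exact: expR_gt0.
have x1 : x < 1 by rewrite /x expR_lt1 oppr_lt0 !mulr_gt0.
have xX (n : nat) : expR (- (2 * pi * h * n%:R)) = x ^+ n.
  by rewrite /x -expRM_natl; congr expR; ring.
pose W := \sum_(i < N) weight rho (freq N i) * (2 / (1 - x)).
have W0 : 0 <= W.
  by apply: sumr_ge0 => i _; rewrite !mulr_ge0 ?expR_ge0 ?invr_ge0 // subr_ge0 ltW.
have W1 : 0 < W + 1 by rewrite ltr_wpDl.
have : ((fun n => x ^+ n) @ \oo --> (0 : R))%classic by apply: cvg_expr; rewrite gtr0_norm.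
move/cvgrPdist_le => /(_ _ (divr_gt0 eps0 W1)) [p _ Hp].
exists p.+1 => //; set L := (p.+1 * N)%N.
have L0 : (0 < L)%N by rewrite muln_gt0.
have xL : x ^+ L <= x by rewrite -[leRHS]expr1 ler_wiXn2l // ltW.
have xp : x ^+ p <= eps / (W + 1).
  by have := Hp p (leqnn p); rewrite /= sub0r normrN gtr0_norm // exprn_gt0.
rewrite -sum_weight_decay ?lt_eqF //.
have -> : alias_sum L N rho h = \sum_(i < N) decay h (freq N i) * weight rho (freq N i)
  + \sum_(i < N) weight rho (freq N i) * (residue_sum h L (freq N i) - decay h (freq N i)).
  rewrite -big_split /=; apply: eq_bigr => i _; ring.
rewrite lerD2l; apply: (@le_trans _ _ (W * x ^+ p)); last first.
  apply: (@le_trans _ _ (W * (eps / (W + 1)))); first by rewrite ler_wpM2l.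
  by rewrite mulrA ler_pdivrMr // mulrC ler_wpM2l ?(ltW eps0) // lerDl.
rewrite /W mulr_suml; apply: ler_sum => i _; rewrite -mulrA ler_wpM2l ?expR_ge0 //.
have kN := freq_le (ltn_ord i); set k := absz (freq N i) in kN *.
have kL : (k <= L)%N by rewrite (leq_trans kN) // leq_pmull.
rewrite /residue_sum /decay -/k -natrB // !xX.
have D : 0 < 1 - x ^+ L by rewrite subr_gt0 (le_lt_trans xL).
have D1 : 0 < 1 - x by rewrite subr_gt0.
have -> : (x ^+ k + x ^+ (L - k)) / (1 - x ^+ L) - x ^+ k =
   (x ^+ (L - k) + x ^+ k * x ^+ L) / (1 - x ^+ L) by field; rewrite gt_eqF.
have Lpk : (k + p <= L)%N by rewrite /L mulSn leq_add // leq_pmulr.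
have Lkp : (p <= L - k)%N by rewrite leq_subRL.
have Lp : (p <= k + L)%N by rewrite (leq_trans (leq_trans (leq_addl k p) Lpk)) // leq_addl.
have A1 : x ^+ (L - k) <= x ^+ p by rewrite ler_wiXn2l // ltW.
have A2 : x ^+ k * x ^+ L <= x ^+ p.
  by rewrite -exprD ler_wiXn2l ?ltW.
rewrite [leRHS]mulrAC ler_pM ?invr_ge0 ?(ltW D) //.
- by rewrite addr_ge0 ?mulr_ge0 ?exprn_ge0 // ltW.
- by rewrite mulr_natl mulr2n lerD.
- by rewrite lef_pV2 ?posrE // lerD2l lerN2.
Qed.

End Counting.

(** * The three functionals in one variable *)

Section Functionals.
Variable R : realType.
Implicit Types (h x y t : R) (k m : int) (z th : R[i]) (g : R[i] -> R[i]).

Definition bounded_functional h (S : seq (R[i] * R[i])) (B : R) :=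
  (forall p, p \in S -> in_strip h p.2) /\
  forall g M, holo h g -> (forall z, in_strip h z -> normc (g z) <= M) ->
    normc (fapply S g) <= M * B.

Lemma bounded_functional_fchar h S B : 0 < h -> (forall p, p \in S -> in_strip h p.2) ->
  (forall s : seq int, uniq s ->
     \sum_(m <- s) decay h m * normc (fapply S (fchar m)) <= B) -> bounded_functional h S B.
Proof. by move=> h0 hS HB; split=> // g M; exact: functional_bound. Qed.

Definition opp_functional (S : seq (R[i] * R[i])) := [seq (- p.1, p.2) | p <- S].

Lemma fapply_cat S T g : fapply (S ++ T) g = fapply S g + fapply T g.
Proof. by rewrite /fapply big_cat. Qed.

Lemma fapply_opp S g : fapply (opp_functional S) g = - fapply S g.
Proof. by rewrite /fapply big_map -sumrN; apply: eq_bigr => p _; rewrite mulNr. Qed.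

Lemma fapply_sub S T g : fapply (S ++ opp_functional T) g = fapply S g - fapply T g.
Proof. by rewrite fapply_cat fapply_opp. Qed.

Lemma sub_in_strip h S T : (forall p, p \in S -> in_strip h p.2) ->
  (forall p, p \in T -> in_strip h p.2) ->
  forall p, p \in S ++ opp_functional T -> in_strip h p.2.
Proof.
move=> hS hT p; rewrite mem_cat => /orP[|/mapP[q qT ->]]; first exact: hS.
exact: (hT q qT).
Qed.

(** The value at th of the part of the discrete Fourier series on L points whose
    frequencies lie in the window of size N. For L = N this is the discrete
    Fourier approximation. *)
Definition grid_partial_sum (L N : nat) th : seq (R[i] * R[i]) :=
  [seq (L%:R^-1 * \sum_(i < N) fchar (freq N i) th * fchar (- freq N i) (j%:R / L%:R : R)%:C,
        (j%:R / L%:R : R)%:C) | j <- iota 0 L].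

Lemma grid_partial_sum_in_strip h L N th : 0 < h ->
  forall p, p \in grid_partial_sum L N th -> in_strip h p.2.
Proof. by move=> h0 p /mapP[j _ ->]; rewrite /in_strip /= normr0. Qed.

Lemma fapply_partial_sumE L N th g : fapply (grid_partial_sum L N th) g =
  \sum_(j < L) (L%:R^-1 * \sum_(i < N) fchar (freq N i) th * fchar (- freq N i) (j%:R / L%:R : R)%:C)
    * g (j%:R / L%:R : R)%:C.
Proof. by rewrite /fapply /grid_partial_sum big_map sum_iota. Qed.

(** Since N divides L, the frequency of the window congruent to m mod L can only
    be the representative of m mod N. *)
Lemma fapply_partial_sum_fchar L N th m : (0 < N)%N -> (0 < L)%N -> (N %| L)%N ->
  fapply (grid_partial_sum L N th) (fchar m) =
  if (L%:Z %| m - window_rep N m)%Z then fchar (window_rep N m) th else 0.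
Proof.
move=> N0 L0 NL; have Lr : (L%:R : R[i]) != 0 by rewrite pnatr_eq0 -lt0n.
have -> : fapply (grid_partial_sum L N th) (fchar m) =
    \sum_(i < N) if (L%:Z %| m - freq N i)%Z then fchar (freq N i) th else 0.
  rewrite fapply_partial_sumE; under eq_bigr do rewrite -mulrA mulr_suml.
  rewrite -mulr_sumr exchange_big /= mulr_sumr; apply: eq_bigr => i _.
  under eq_bigr do rewrite -mulrA -fcharDk.
  rewrite -mulr_sumr addrC sum_fchar_grid //.
  by case: ifP => _; rewrite ?mulr0 // mulrCA mulVf // mulr1.
have [i ri di] := window_repP m N0.
rewrite (bigD1 i) //= -ri big1 ?addr0 // => j ji.
case: ifPn => // dj; move: ji; rewrite -val_eqE /= => /eqP[].
apply: (freq_inj_mod (ltn_ord j) (ltn_ord i)).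
have -> : freq N j - freq N i = (m - freq N i) - (m - freq N j) by ring.
rewrite rpredB //; rewrite !dvdzE !absz_nat in dj *.
exact: dvdn_trans NL dj.
Qed.

Lemma window_rep_id N m : (0 < N)%N ->
  m \in [seq freq N i | i <- iota 0 N] -> window_rep N m = m.
Proof.
move=> N0 /mapP[j]; rewrite mem_iota /= add0n => jN ->.
exact: (window_rep_freq (Ordinal jN)).
Qed.

Lemma normc_fchar_le rho k z : `|complex.Im z| <= rho ->
  normc (fchar k z) <= weight rho k.
Proof.
move=> zr; have r0 : 0 <= rho by apply: le_trans zr.
rewrite normc_fchar /weight ler_expR.
have -> : - (2 * pi * k%:~R * complex.Im z) = 2 * pi * (- (k%:~R * complex.Im z)) by ring.
rewrite -[leRHS]mulrA ler_wpM2l ?mulr_ge0 ?pi_ge0 //.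
apply: le_trans (ler_norm _) _; rewrite normrN normrM mulrC ler_pM //.
by rewrite -intr_norm -abszE.
Qed.

(** Q is the partial sum on a fine grid whose size is a multiple of N, so that Q
    and the grid operator agree on the characters of the window and the
    difference only sees frequencies outside it. *)
Lemma one_variable_splitting rho h N th (eps : R) : 0 <= rho -> rho < h -> (0 < N)%N ->
  `|complex.Im th| <= rho -> 0 < eps ->
  exists Q, [/\ bounded_functional h Q (nu N (h - rho) + eps),
    bounded_functional h (grid_partial_sum N N th ++ opp_functional Q) (alias_sum N N rho h - nu N (h - rho)) &
    bounded_functional h ([:: (1, th)] ++ opp_functional Q) (coth (h - rho) - nu N (h - rho) + eps)].
Proof.
move=> r0 rh N0 thr eps0; have h0 : 0 < h by apply: le_lt_trans rh.
have [p p0 Hp] := alias_sum_lim r0 rh N0 eps0.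
set L := (p * N)%N in Hp.
have L0 : (0 < L)%N by rewrite muln_gt0 p0.
have NL : (N %| L)%N by rewrite dvdn_mull.
have nuE := @sum_weight_decay R h rho N (negbT (lt_eqF rh)).
have th_in : in_strip h th by apply: le_lt_trans rh.
set I := [seq freq N i | i <- iota 0 N].
have wd0 k m : 0 <= decay h k * weight rho m by rewrite mulr_ge0 ?expR_ge0.
have QE m := fapply_partial_sum_fchar th m N0 L0 NL.
have PE m : fapply (grid_partial_sum N N th) (fchar m) = fchar (window_rep N m) th.
  rewrite fapply_partial_sum_fchar // ifT //.
  by have [i -> ] := window_repP m N0.
exists (grid_partial_sum L N th); split.
- apply: bounded_functional_fchar => //; first exact: grid_partial_sum_in_strip.
  move=> s us; apply: le_trans Hp; apply: le_trans (sum_residue rho h0 N0 NL L0 us).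
  rewrite [leRHS]big_mkcond /=; apply: ler_sum => m _; rewrite QE.
  case: ifP => _; last by rewrite Normc.normc0 mulr0.
  by rewrite ler_wpM2l ?expR_ge0 // normc_fchar_le.
- apply: bounded_functional_fchar => //; first by apply: sub_in_strip; exact: grid_partial_sum_in_strip.
  move=> s us; rewrite -nuE.
  have F0 m : 0 <= decay h m * weight rho (window_rep N m) by [].
  have FB (s' : seq int) : uniq s' ->
      \sum_(m <- s') decay h m * weight rho (window_rep N m) <= alias_sum N N rho h.
    move=> us'; apply: le_trans (sum_residue rho h0 N0 (dvdnn N) N0 us').
    rewrite [leRHS](eq_bigl xpredT) // => m.
    by have [i -> ] := window_repP m N0.
  have := sum_off_window N F0 FB us.
  under [X in _ - X]eq_bigr do rewrite window_rep_freq.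
  apply: le_trans; rewrite [leRHS]big_mkcond /=; apply: ler_sum => m _.
  rewrite fapply_sub QE PE; have [mI|mI] := boolP (m \in _).
    by rewrite (window_rep_id N0 mI) subrr dvdz0 subrr Normc.normc0 mulr0.
  rewrite /=; case: ifP => _; first by rewrite subrr Normc.normc0 mulr0.
  by rewrite subr0 ler_wpM2l ?expR_ge0 // normc_fchar_le.
- apply: bounded_functional_fchar => //.
    apply: sub_in_strip; last exact: grid_partial_sum_in_strip.
    by move=> q; rewrite inE => /eqP ->.
  move=> s us.
  apply: (@le_trans _ _ ((\sum_(m <- s | m \notin I) decay h m * weight rho m) +
    \sum_(m <- s | m \notin I) if (L%:Z %| m - window_rep N m)%Z then decay h m * weight rho (window_rep N m) else 0)).
    rewrite -big_split [leRHS]big_mkcond; apply: ler_sum => m _.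
    rewrite fapply_sub QE {1}/fapply big_seq1 mul1r /=; have [mI|mI] := boolP (m \in I).
      by rewrite (window_rep_id N0 mI) subrr dvdz0 subrr Normc.normc0 mulr0.
    rewrite /=; apply: le_trans (ler_wpM2l (expR_ge0 _) (le_normcD _ _)) _.
    rewrite mulrDr normcN lerD //; first by rewrite ler_wpM2l ?expR_ge0 // normc_fchar_le.
    case: ifP => _; last by rewrite Normc.normc0 mulr0.
    by rewrite ler_wpM2l ?expR_ge0 // normc_fchar_le.
  have A := sum_off_window N (fun m => wd0 m m) (fun s us => sum_all rh us) us.
  have F0 m : 0 <= (if (L%:Z %| m - window_rep N m)%Z then decay h m * weight rho (window_rep N m) else 0).
    by case: ifP.
  have FB (s' : seq int) : uniq s' ->
      \sum_(m <- s') (if (L%:Z %| m - window_rep N m)%Z then decay h m * weight rho (window_rep N m) else 0)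
        <= nu N (h - rho) + eps.
    move=> us'; apply: le_trans Hp; rewrite -big_mkcond /=; exact: sum_residue.
  have B := sum_off_window N F0 FB us.
  rewrite nuE in A; move: B; under [X in _ - X]eq_bigr do rewrite window_rep_freq subrr dvdz0.
  rewrite nuE; move: A; rewrite -/I; lra.
Qed.

End Functionals.

(** * Functionals acting on separate variables *)

Section SeparateOperators.
Variables (R : realType) (n : nat).
Implicit Types (h x y t : R) (z : R[i]) (g : R[i] -> R[i]).
Implicit Types (th eta : 'rV[R[i]]_n) (l : 'I_n) (f : 'rV[R[i]]_n -> R[i]).

Lemma holo_cst h (c : R[i]) : holo h (fun=> c).
Proof. by split=> // z _; exact: strictly_diff_cst. Qed.

Lemma holo_lin h (I : eqType) (s : seq I) (w : I -> R[i]) (F : I -> R[i] -> R[i]) :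
  (forall p, p \in s -> holo h (F p)) -> holo h (fun z => \sum_(p <- s) w p * F p z).
Proof.
move=> hF; split=> z hz.
  by rewrite big_seq [RHS]big_seq; apply: eq_bigr => p ps; rewrite (hF p ps).1.
by apply: strictly_diff_sum => p ps; apply: strictly_diffZ; exact: (hF p ps).2.
Qed.

Lemma holoB h g1 g2 : holo h g1 -> holo h g2 -> holo h (fun z => g1 z - g2 z).
Proof.
move=> [p1 s1] [p2 s2]; split=> z hz; first by rewrite p1 ?p2.
have -> : (fun z => g1 z - g2 z) = (fun z => g1 z + (-1) * g2 z).
  by apply/funext => w; rewrite mulN1r.
by apply: strictly_diffD; [exact: s1 | apply: strictly_diffZ; exact: s2].
Qed.

Definition set_coord th l z : 'rV[R[i]]_n := \row_k (if k == l then z else th 0 k).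

Lemma set_coord_strip h th l z : cstrip h th -> in_strip h z ->
  cstrip h (set_coord th l z).
Proof. by move=> hth hz k; rewrite mxE; case: eqP. Qed.

Lemma set_coord_twice th l z w : set_coord (set_coord th l z) l w = set_coord th l w.
Proof. by apply/rowP => k; rewrite !mxE; case: eqP. Qed.

Lemma set_coordC th l k z w : l != k ->
  set_coord (set_coord th k z) l w = set_coord (set_coord th l w) k z.
Proof.
move=> lk; apply/rowP => j; rewrite !mxE; case: eqP => [->|//].
by rewrite (negPf lk).
Qed.

Definition sep_holo h f := forall th l, cstrip h th ->
  holo h (fun z => f (set_coord th l z)).

Definition bounded_by h M f := forall th, cstrip h th -> normc (f th) <= M.

Definition act_coord l (S : seq (R[i] * R[i])) f th : R[i] :=
  fapply S (fun z => f (set_coord th l z)).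

Lemma act_coord_bounded h S B M l f : bounded_functional h S B -> sep_holo h f ->
  bounded_by h M f ->
  bounded_by h (M * B) (act_coord l S f).
Proof.
move=> [_ hS] hf fM th hth; apply: hS; first exact: hf.
by move=> z hz; apply: fM; exact: set_coord_strip.
Qed.

(** In the variable that is acted on the result is constant; in any other one it
    is a finite combination of slices of f. *)
Lemma act_coord_sep_holo h S l f : (forall p, p \in S -> in_strip h p.2) ->
  sep_holo h f ->
  sep_holo h (act_coord l S f).
Proof.
move=> hS hf th k hth; rewrite /act_coord /fapply.
have [->|kl] := eqVneq l k.
  have -> : (fun z => \sum_(p <- S) p.1 * f (set_coord (set_coord th k z) k p.2)) =
            (fun=> \sum_(p <- S) p.1 * f (set_coord th k p.2)).
    by apply/funext => z; apply: eq_bigr => p _; rewrite set_coord_twice.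
  exact: holo_cst.
have -> : (fun z => \sum_(p <- S) p.1 * f (set_coord (set_coord th k z) l p.2)) =
          (fun z => \sum_(p <- S) p.1 * f (set_coord (set_coord th l p.2) k z)).
  by apply/funext => z; apply: eq_bigr => p _; rewrite set_coordC.
apply: holo_lin => p pS; apply: hf; apply: set_coord_strip => //; exact: hS.
Qed.

Definition act_coords (s : seq 'I_n) (S : 'I_n -> seq (R[i] * R[i])) f :=
  foldr (fun l F => act_coord l (S l) F) f s.

Lemma act_coords_sep_holo h s S f : (forall l p, p \in S l -> in_strip h p.2) ->
  sep_holo h f -> sep_holo h (act_coords s S f).
Proof. by move=> hS hf; elim: s => //= l s IH; apply: act_coord_sep_holo => //; exact: hS. Qed.

Lemma bounded_functional_triangle h S T q a : bounded_functional h T q ->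
  bounded_functional h (S ++ opp_functional T) a ->
  (forall p, p \in S -> in_strip h p.2) /\ bounded_functional h S (q + a).
Proof.
move=> [_ HT] [hST HST].
have hS p : p \in S -> in_strip h p.2 by move=> pS; apply: hST; rewrite mem_cat pS.
split=> //; split=> // g M hg gM.
have -> : fapply S g = fapply T g + fapply (S ++ opp_functional T) g by rewrite fapply_sub addrC subrK.
by rewrite mulrDr (le_trans (le_normcD _ _)) // lerD ?HT ?HST.
Qed.

(** Telescoping: S_l S' - T_l T' = S_l (S' - T') + (S_l - T_l) T', where S_l has
    norm at most q_l + a_l. *)
Lemma act_coords_diff_bounded h M f (S T : 'I_n -> seq (R[i] * R[i])) (q a : 'I_n ->
  R) s :
  (forall l, bounded_functional h (T l) (q l)) ->
  (forall l, bounded_functional h (S l ++ opp_functional (T l)) (a l)) ->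
  sep_holo h f -> bounded_by h M f ->
  bounded_by h (M * \prod_(l <- s) q l) (act_coords s T f) /\
  bounded_by h (M * (\prod_(l <- s) (q l + a l) - \prod_(l <- s) q l))
    (fun th => act_coords s S f th - act_coords s T f th).
Proof.
move=> hT hST hf fM.
have hS l := bounded_functional_triangle (hT l) (hST l).
have sS s' := @act_coords_sep_holo h s' S f (fun l => (hS l).1) hf.
have sT s' := @act_coords_sep_holo h s' T f (fun l => (hT l).1) hf.
elim: s => [|l s [IT ID]].
  rewrite !big_nil mulr1 subrr mulr0 /=; split=> // th _.
  by rewrite subrr Normc.normc0.
split.
  rewrite big_cons mulrCA mulrC; exact: act_coord_bounded (hT l) (sT s) IT.
move=> th hth; rewrite !big_cons /=.
have -> : act_coord l (S l) (act_coords s S f) th - act_coord l (T l) (act_coords s T f) th =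
   act_coord l (S l) (fun th => act_coords s S f th - act_coords s T f th) th +
   act_coord l (S l ++ opp_functional (T l)) (act_coords s T f) th.
  rewrite /act_coord fapply_sub.
  have -> : fapply (S l) (fun z => act_coords s S f (set_coord th l z) - act_coords s T f (set_coord th l z)) =
    fapply (S l) (fun z => act_coords s S f (set_coord th l z)) - fapply (S l) (fun z => act_coords s T f (set_coord th l z)).
    by rewrite /fapply -sumrB; apply: eq_bigr => p _; rewrite mulrBr.
  by rewrite addrA subrK.
have sD : sep_holo h (fun th => act_coords s S f th - act_coords s T f th).
  by move=> th' k hth'; apply: holoB; [exact: sS | exact: sT].
have B1 := act_coord_bounded l (hS l).2 sD ID hth.
have B2 := act_coord_bounded l (hST l) (sT s) IT hth.
apply: le_trans (le_normcD _ _) _; apply: le_trans (lerD B1 B2) _.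
by rewrite le_eqVlt; apply/orP; left; apply/eqP; ring.
Qed.

Lemma act_coords_eval s f th eta :
  act_coords s (fun l => [:: (1, th 0 l)]) f eta =
  f (\row_l (if l \in s then th 0 l else eta 0 l)).
Proof.
elim: s eta => [|l s IH] eta /=; first by congr f; apply/rowP => l; rewrite mxE.
rewrite /act_coord /fapply big_seq1 mul1r IH; congr f; apply/rowP => k; rewrite !mxE inE.
by have [->|] := eqVneq k l; case: ifP.
Qed.

Section GridExpansion.
Variables (N : 'I_n -> nat) (w pt : 'I_n -> nat -> R[i]).
Hypothesis N_gt0 : forall l, (0 < N l)%N.

Local Notation grid := {dffun forall l : 'I_n, 'I_(N l)}.

Definition grid_update (j : grid) l (i : 'I_(N l)) : grid :=
  finfun (@eqtype.dfwith _ (fun k => 'I_(N k)) (fun k => j k) l i).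

(** The map (j, i) |-> (j with i at l, j l) is an involution, hence a
    bijection. *)
Lemma sum_grid_update l (G : grid -> R[i]) :
  \sum_(j : grid) \sum_(i < N l) G (grid_update j i) = (N l)%:R * \sum_(j : grid) G j.
Proof.
pose sw (p : grid * 'I_(N l)) := (grid_update p.1 p.2, p.1 l).
have swK : involutive sw.
  move=> [j i]; rewrite /sw /=; congr (_, _); last by rewrite ffunE eqtype.dfwith_in.
  apply/ffunP => k; rewrite ffunE; case: eqtype.dfwithP => // k' lk.
  by rewrite ffunE eqtype.dfwith_out.
rewrite pair_big /= (reindex_inj (inv_inj swK)) /=.
rewrite (eq_bigr (fun p : grid * 'I_(N l) => G p.1)); last first.
  move=> [j i] _ /=; congr G; apply/ffunP => k; rewrite ffunE.
  by case: eqtype.dfwithP => // k' lk; rewrite ffunE eqtype.dfwith_out.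
rewrite -(pair_big xpredT xpredT (fun j _ => G j)) /= mulr_sumr; apply: eq_bigr => j _.
by rewrite sumr_const card_ord mulr_natl.
Qed.

(** Coordinates on which no functional acts yet are averaged out, so that the sum
    always runs over the whole grid. *)
Definition grid_weight (s : seq 'I_n) (j : grid) : R[i] :=
  \prod_l (if l \in s then w l (j l) else (N l)%:R^-1).

Definition partial_grid_point (s : seq 'I_n) (j : grid) eta : 'rV[R[i]]_n :=
  \row_l (if l \in s then pt l (j l) else eta 0 l).

Lemma act_coords_grid s f eta : uniq s ->
  act_coords s (fun l => [seq (w l j, pt l j) | j <- iota 0 (N l)]) f eta =
  \sum_(j : grid) grid_weight s j * f (partial_grid_point s j eta).
Proof.
have Nr l : ((N l)%:R : R[i]) != 0 by rewrite pnatr_eq0 -lt0n.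
elim: s eta => [|l s IH] eta /=.
  have -> : \sum_(j : grid) grid_weight [::] j * f (partial_grid_point [::] j eta) =
      (\prod_l (N l)%:R^-1) * (#|grid|%:R * f eta).
    rewrite mulr_natl -sumr_const mulr_sumr; apply: eq_bigr => j _.
    rewrite /grid_weight /=; congr (_ * f _).
    by apply/rowP => k; rewrite mxE.
  move=> _; rewrite mulrA.
  have -> : #|grid| = (\prod_l N l)%N.
    rewrite card_dep_ffun foldrE big_map -big_enum /=.
    by apply: eq_bigr => k _; rewrite card_ord.
  rewrite natr_prod -big_split /= big1 ?mul1r // => k _.
  by rewrite mulVf.
move=> /andP[ls us].
rewrite /act_coord /fapply big_map sum_iota /=.
under eq_bigr do rewrite IH // mulr_sumr.
rewrite exchange_big /=.
pose G j := grid_weight (l :: s) j * f (partial_grid_point (l :: s) j eta).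
rewrite (eq_bigr (fun j : grid => \sum_(i < N l) (N l)%:R^-1 * G (grid_update j i))); last first.
  move=> j _; apply: eq_bigr => i _; rewrite /G mulrA mulrA; congr (_ * f _).
    rewrite /grid_weight (bigD1 l) //= [in RHS](bigD1 l) //= (negPf ls) mem_head.
    rewrite ffunE eqtype.dfwith_in mulrCA; congr (_ * (_ * _)).
    apply: eq_bigr => k kl; rewrite inE (negPf kl) /=.
    by rewrite ffunE eqtype.dfwith_out // eq_sym.
  apply/rowP => k; rewrite !mxE inE.
  have [->|kl] := eqVneq k l; first by rewrite (negPf ls) ffunE eqtype.dfwith_in.
  by rewrite ffunE eqtype.dfwith_out // eq_sym.
under eq_bigr do rewrite -mulr_sumr.
by rewrite -mulr_sumr sum_grid_update mulrA mulVf // mul1r.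
Qed.

End GridExpansion.

End SeparateOperators.

(** * Power series are strictly differentiable at their centre *)

Section PowerSeries.
Variable R : realType.
Implicit Types (z x y u : R[i]) (g : R[i] -> R[i]).

Lemma normc_subX x y (s : R) (d : nat) : normc x <= s -> normc y <= s ->
  normc (x ^+ d - y ^+ d) <= normc (x - y) * (d%:R * s ^+ d.-1).
Proof.
move=> xs ys; have s0 : 0 <= s by apply: le_trans xs; exact: normc_ge0.
rewrite subrXX Normc.normcM ler_wpM2l ?normc_ge0 //.
apply: le_trans (le_normc_sum _ _ _) _.
apply: (@le_trans _ _ (\sum_(i < d) s ^+ d.-1)); last by rewrite sum_ord_cst mulrC.
apply: ler_sum => i _; rewrite Normc.normcM !normcX.
have -> : d.-1 = (d.-1 - i + i)%N by have := ltn_ord i; lia.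
by rewrite exprD addnK ler_pM ?exprn_ge0 ?normc_ge0 // lerXn2r // nnegrE normc_ge0.
Qed.

Lemma ler_nat_exp2 (d : nat) : d%:R <= 2 ^+ d :> R.
Proof. by rewrite -natrX ler_nat ltnW // ltn_expl. Qed.

Lemma cvg_totallyP (I : choiceType) (F : I -> R[i]) (v : R[i]) :
  ((partial_sum (F : I -> R[i]^o) @ totally --> (v : R[i]^o))%classic) ->
  forall eps : R, 0 < eps -> exists A0 : {fset I}, forall A : {fset I},
    (A0 `<=` A)%fset -> normc (\sum_(a <- A) F a - v) <= eps.
Proof.
move=> Fv eps eps0.
have e0 : (0 : R[i]) < eps%:C by rewrite ltcR.
have /cvgrPdist_le/(_ _ e0) := Fv.
have FT : Filter (@totally I) by exact: (@totally_filter I).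
move=> /(_ FT) [A0 _ HA]; exists A0 => A A0A.
have := HA A A0A; rewrite /= /partial_sum normcB.
rewrite big_seq_fsetE /=.
by rewrite -lecR.
Qed.

(** The series is indexed by I with exponents d, in order to apply to a series in
    several variables restricted to a line, where only the [pure] indices
    contribute. Convergence at r / 2 bounds the coefficients geometrically;
    since |x^d - y^d| <= d s^(d-1) |x - y| for |x|, |y| <= s, the terms of degree
    at least 2 contribute O(s) |x - y|. *)
Lemma power_series_strictly_diff (I : choiceType) (c : I -> R[i]) (d : I ->
  nat) (pure : pred I)
    (a1 : I) (r : R) g z :
  0 < r -> pure a1 -> d a1 = 1%N -> {in pure &, injective d} ->
  (forall u, normc u < r -> forall eps : R, 0 < eps ->
    exists A0 : {fset I}, forall A : {fset I}, (A0 `<=` A)%fset ->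
    normc (\sum_(a <- A) (if pure a then c a * u ^+ d a else 0) - g (z + u)) <= eps) ->
  strictly_diff g z.
Proof.
move=> r0 pa1 da1 dI Hg.
have r2 : 0 < r / 2 by rewrite divr_gt0.
have rr : normc (r / 2)%:C < r by rewrite normc_real gtr0_norm //; lra.
have [B B0 cB] : exists2 B : R, 0 < B & forall a, pure a -> normc (c a) <= B * (2 / r) ^+ d a.
  have [A0 HA] := Hg _ rr _ ltr01.
  pose t a := if pure a then c a * (r / 2)%:C ^+ d a else 0.
  exists (2 + \sum_(a <- A0) normc (t a)).
    by rewrite ltr_pwDl // sumr_ge0 // => a _; exact: normc_ge0.
  move=> a pa.
  have ta : normc (c a) = normc (t a) * (2 / r) ^+ d a.
    rewrite /t pa Normc.normcM normcX normc_real (gtr0_norm r2) -mulrA -exprMn.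
    have -> : r / 2 * (2 / r) = 1 by field; rewrite gt_eqF.
    by rewrite expr1n mulr1.
  rewrite ta ler_wpM2r ?exprn_ge0 ?divr_ge0 ?(ltW r0) //.
  have [aA|aA] := boolP (a \in A0).
    rewrite (big_rem a aA) /= addrCA lerDl addr_ge0 // sumr_ge0 // => b _; exact: normc_ge0.
  apply: (@le_trans _ _ 2); last by rewrite lerDl sumr_ge0 // => b _; exact: normc_ge0.
  have H1 := HA A0 (fsubset_refl _); have H2 := HA (a |` A0)%fset (fsubsetUr _ _).
  rewrite big_fsetU1 //= -/(t a) in H2.
  have -> : t a = (t a + \sum_(i <- A0) t i - g (z + (r / 2)%:C)) - (\sum_(i <- A0) t i - g (z + (r / 2)%:C)).
    ring.
  apply: le_trans (le_normcD _ _) _; rewrite normcN.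
  by move: H1 H2; rewrite -/t; lra.
exists (c a1) => eps eps0.
(* d <= 2^d bounds the term of degree d by B (4 / r) v^(d-1), with v = 4 s / r,
   and the sum over d >= 2 by B (4 / r) (2 v) = C s *)
pose C := B * (4 / r) * 2 * (4 / r).
have C0 : 0 < C by rewrite /C !mulr_gt0 ?invr_gt0.
exists (Num.min (r / 8) (eps / C)); first by rewrite lt_min !divr_gt0.
move=> x' y'; rewrite !lt_min => /andP[x8 xe] /andP[y8 ye].
pose x := x' - z; pose y := y' - z.
have xz : x' = z + x by rewrite /x addrC subrK.
have yz : y' = z + y by rewrite /y addrC subrK.
have xy : x' - y' = x - y by rewrite xz yz; ring.
rewrite xy xz yz; rewrite -/x in x8 xe; rewrite -/y in y8 ye.
apply/ler_addgt0Pr => e e0; have e2 : 0 < e / 2 by rewrite divr_gt0.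
have xr : normc x < r by lra.
have yr : normc y < r by lra.
have [A1 H1] := Hg _ xr _ e2; have [A2 H2] := Hg _ yr _ e2.
pose A := (a1 |` (A1 `|` A2))%fset.
have {}H1 := H1 A (fsubset_trans (fsubsetUl _ _) (fsubsetUr _ _)).
have {}H2 := H2 A (fsubset_trans (fsubsetUr _ _) (fsubsetUr _ _)).
have a1A : a1 \in (A : {fset I}) by rewrite fset1U1.
pose t u a := if pure a then c a * u ^+ d a else 0.
rewrite -/(t x) in H1; rewrite -/(t y) in H2.
have -> : g (z + x) - g (z + y) - c a1 * (x - y) =
   (\sum_(a <- A) t x a - \sum_(a <- A) t y a - c a1 * (x - y))
   - ((\sum_(a <- A) t x a - g (z + x)) - (\sum_(a <- A) t y a - g (z + y))) by ring.
apply: le_trans (le_normcD _ _) _; rewrite normcN.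
have T : normc ((\sum_(a <- A) t x a - g (z + x)) - (\sum_(a <- A) t y a - g (z + y))) <= e.
  apply: le_trans (le_normcD _ _) _; rewrite normcN.
  by move: H1 H2; rewrite -/t /t; lra.
suff S : normc (\sum_(a <- A) t x a - \sum_(a <- A) t y a - c a1 * (x - y)) <= eps * normc (x - y).
  by apply: lerD.
pose s := Num.max (normc x) (normc y).
have xs : normc x <= s by rewrite le_max lexx.
have ys : normc y <= s by rewrite le_max lexx orbT.
have s0 : 0 <= s by apply: le_trans xs; exact: normc_ge0.
have s8 : s < r / 8 by rewrite gt_max x8 y8.
have se : s < eps / C by rewrite gt_max xe ye.
pose v := 4 * s / r.
have v0 : 0 <= v by rewrite /v divr_ge0 ?mulr_ge0 // ltW.
have v2 : v <= 1 / 2 by rewrite /v ler_pdivrMr //; lra.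
pose A' := [seq a <- rem a1 A | pure a && (d a != 0%N)].
have uA : uniq (A : seq I) by exact: fset_uniq.
have A'P a : a \in A' -> pure a /\ (2 <= d a)%N.
  rewrite mem_filter (mem_rem_uniq _ uA) inE => /andP[/andP[pa da0] /andP[aa1 _]].
  split; first exact: pa.
  have da1' : d a != 1%N.
    by apply: contra aa1 => /eqP da; apply/eqP/dI; rewrite // da da1.
  by move: da0 da1'; case: (d a) => [|[|?]].
have -> : \sum_(a <- A) t x a - \sum_(a <- A) t y a - c a1 * (x - y) =
   \sum_(a <- A') c a * (x ^+ d a - y ^+ d a).
  rewrite -sumrB (big_rem a1 a1A) /= {1 2}/t pa1 da1 !expr1 -mulrBr addrAC subrr add0r.
  rewrite big_filter big_mkcond [RHS]big_mkcond /=; apply: eq_bigr => a _.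
  rewrite /t; case: (pure a) => /=; last by rewrite subrr.
  by case: eqP => [->|_] /=; rewrite ?expr0 ?subrr // mulrBr.
apply: le_trans (le_normc_sum _ _ _) _.
apply: (@le_trans _ _ (\sum_(a <- A') normc (x - y) * (B * (4 / r) * v * v ^+ (d a - 2)))).
  rewrite big_seq [leRHS]big_seq; apply: ler_sum => a aA'; have [pa d2] := A'P a aA'.
  rewrite Normc.normcM.
  apply: le_trans (ler_pM (normc_ge0 _) (normc_ge0 _) (cB _ pa) (normc_subX _ xs ys)) _.
  rewrite mulrCA ler_wpM2l ?normc_ge0 //.
  have -> : B * (4 / r) * v * v ^+ (d a - 2) = B * ((2 / r) ^+ d a * (2 ^+ d a * s ^+ (d a).-1)).
    have [k de] : exists k, d a = k.+2 by move: d2; case: (d a) => [|[|m]] // _; exists m.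
    rewrite de subSS subSS subn0 /= /v !exprS !exprMn exprVn.
    rewrite -[4]/((2 + 2)%:R) natrD.
    have -> : (2 + 2 : R) ^+ k = 2 ^+ k * 2 ^+ k by rewrite -exprMn; congr (_ ^+ _); ring.
    field.
    by rewrite expf_neq0 ?gt_eqF.
  rewrite -mulrA ler_wpM2l ?(ltW B0) // ler_wpM2l ?exprn_ge0 ?divr_ge0 ?(ltW r0) //.
  by rewrite ler_wpM2r ?exprn_ge0 // ler_nat_exp2.
rewrite -mulr_sumr mulrC ler_wpM2r ?normc_ge0 // -mulr_sumr.
have vsum : \sum_(a <- A') v ^+ (d a - 2) <= 2.
  have -> : \sum_(a <- A') v ^+ (d a - 2) = \sum_(e <- [seq (d a - 2)%N | a <- A']) v ^+ e.
    by rewrite big_map.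
  have uA' : uniq [seq (d a - 2)%N | a <- A'].
    rewrite map_inj_in_uniq ?filter_uniq ?rem_uniq // => a b /A'P[pa a2] /A'P[pb b2] ab.
    by apply: dI => //; rewrite -(subnK a2) ab subnK.
  have [T' HT'] : exists T', {subset [seq (d a - 2)%N | a <- A'] <= iota 0 T'}.
    exists (\sum_(k <- [seq (d a - 2)%N | a <- A']) k).+1 => k ks.
    by rewrite mem_iota /= add0n ltnS (big_rem k ks) leq_addr.
  apply: (@le_trans _ _ (\sum_(e <- iota 0 T') v ^+ e)).
    by apply: ler_sum_subset => // k; rewrite exprn_ge0.
  have v01 : 0 <= v < 1 by rewrite v0 /=; lra.
  rewrite sum_iota; apply: le_trans (geo_sum_le _ v01) _.
  rewrite -[leRHS]invrK lef_pV2 ?posrE ?invr_gt0 //; lra.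
apply: (@le_trans _ _ (B * (4 / r) * v * 2)).
  by rewrite ler_wpM2l // !mulr_ge0 ?invr_ge0 ?(ltW B0) ?(ltW r0).
have -> : B * (4 / r) * v * 2 = C * s by rewrite /C /v; ring.
by rewrite mulrC -ler_pdivlMr // ltW.
Qed.

End PowerSeries.

Section AnalyticSepholo.
Variables (R : realType) (n : nat).

(** On a line parallel to an axis, a monomial with a positive exponent in another
    variable vanishes. *)
Lemma analytic_sep_holo (h : R) (f : 'rV[R[i]]_n -> R[i]) :
  periodic_on (cstrip h) f -> analytic_on (cstrip h) f -> sep_holo h f.
Proof.
move=> fper fan th l hth; split=> z hz.
  have -> : set_coord th l (z + 1) = set_coord th l z + map_mx intr (\row_k (k == l)%:Z).
    apply/rowP => k; rewrite !mxE; case: eqP => _ //=.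
    by rewrite addr0.
  apply: fper; exact: set_coord_strip.
have [r [c [r0 Hc]]] := fan _ (set_coord_strip l hth hz).
pose pure (a : {ffun 'I_n -> nat}) := [forall k, (k != l) ==> (a k == 0%N)].
pose a1 : {ffun 'I_n -> nat} := [ffun k => (k == l : nat)].
apply: (@power_series_strictly_diff _ _ c (fun a : {ffun 'I_n -> nat} => a l) pure a1 r) => //.
- by apply/forallP => k; rewrite ffunE; case: eqP.
- by rewrite ffunE eqxx.
- move=> a b /forallP pa /forallP pb ab; apply/ffunP => k.
  have [->//|kl] := eqVneq k l.
  by have /implyP/(_ kl)/eqP -> := pa k; have /implyP/(_ kl)/eqP -> := pb k.
move=> u ur eps eps0.
have close k : normc (set_coord th l (z + u) 0 k - set_coord th l z 0 k) < r.
  rewrite !mxE; case: eqP => _; last by rewrite subrr Normc.normc0.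
  by rewrite addrC addKr.
have [A0 HA] := cvg_totallyP (Hc _ close) eps0.
exists A0 => A A0A; have := HA A A0A.
congr (normc (_ - _) <= _); apply: eq_bigr => a _.
case: ifPn => [/forallP pa|/forallPn[k]].
  congr (_ * _); rewrite (bigD1 l) //= big1 ?mulr1.
    by rewrite !mxE eqxx addrC addKr.
  by move=> k kl; have /implyP/(_ kl)/eqP -> := pa k; rewrite expr0.
rewrite negb_imply => /andP[kl ak].
rewrite (bigD1 k) //= !mxE (negPf kl) subrr expr0n (negPf ak) mul0r mulr0 //.
Qed.

End AnalyticSepholo.

(** * The discrete Fourier approximation as a product of grid operators *)

Section DFT.
Variables (R : realType) (n : nat) (N : 'I_n -> nat).
Hypothesis N_gt0 : forall l, (0 < N l)%N.
Implicit Types (f : 'rV[R[i]]_n -> R[i]) (th : 'rV[R[i]]_n).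

Local Notation grid := {dffun forall l : 'I_n, 'I_(N l)}.

(** Expands the action of the weights on the constant function 1. *)
Lemma sum_grid_prod (w : 'I_n -> nat -> R[i]) :
  \sum_(j : grid) \prod_l w l (j l) = \prod_l \sum_(i < N l) w l i.
Proof.
have := act_coords_grid w (fun _ _ => 0) N_gt0 (fun=> 1) 0 (index_enum_uniq _).
rewrite /grid_weight.
under [X in _ = X -> _]eq_bigr do under eq_bigr do rewrite mem_index_enum.
under [X in _ = X -> _]eq_bigr do rewrite mulr1.
move=> <-.
suff E (s : seq 'I_n) eta : act_coords s (fun l => [seq (w l j, 0 : R[i]) | j <- iota 0 (N l)]) (fun=> 1) eta
    = \prod_(l <- s) \sum_(i < N l) w l i by rewrite E.
elim: s eta => [|l s IH] eta; first by rewrite big_nil.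
rewrite big_cons /= /act_coord /fapply big_map sum_iota mulr_suml.
by apply: eq_bigr => j _; rewrite IH.
Qed.

Definition freq_row (j : grid) : 'rV[int]_n := \row_l freq (N l) (j l).

Lemma freq_bound (M : nat) k : (0 < M)%N ->
  (- (M%:Q / 2) <= k%:Q < M%:Q / 2) =
  ((0 <= k + (M./2)%:Z) && (k + (M./2)%:Z < M%:Z)).
Proof.
move=> M0.
have -> : (- (M%:Q / 2) <= k%:Q < M%:Q / 2) = (- M%:Z <= k *+ 2 < M%:Z).
  rewrite -!(ltr_int rat) -(ler_int rat) intrN rmorphMn /= -mulNr.
  by rewrite ler_pdivrMr // ltr_pdivlMr // mulr_natr.
by apply/idP/idP; lia.
Qed.

Lemma freq_row_bij : set_bij setT (@freq_set n N) freq_row.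
Proof.
split.
- move=> j _ l; rewrite freq_bound // mxE /freq subrK /=.
  by rewrite ltz_nat ltn_ord.
- move=> j j' _ _ /rowP jj; apply/ffunP => l; apply/val_inj.
  by have := jj l; rewrite !mxE => /addIr[].
move=> k hk.
have kl l : (absz (k 0 l + ((N l)./2)%:Z)%R < N l)%N.
  by have := hk l; rewrite freq_bound // => /andP[a b]; lia.
exists (finfun (fun l => Ordinal (kl l)) : grid) => //.
apply/rowP => l; rewrite mxE ffunE /= /freq.
have := hk l; rewrite freq_bound // => /andP[a _].
by rewrite gez0_abs // addrK.
Qed.

Lemma cexp_phase (k : 'rV[int]_n) th : cexp (phase k th) = \prod_l fchar (k 0 l) (th 0 l).
Proof. by rewrite /phase mulr_sumr cexp_sum. Qed.

Lemma dft_approxE f th : dft_approx N f th =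
  act_coords (index_enum 'I_n) (fun l => grid_partial_sum (N l) (N l) (th 0 l)) f th.
Proof.
rewrite (act_coords_grid (fun l j => (N l)%:R^-1 * \sum_(i < N l) fchar (freq (N l) i) (th 0 l) *
    fchar (- freq (N l) i) (j%:R / (N l)%:R : R)%:C)
  (fun l j => (j%:R / (N l)%:R : R)%:C) N_gt0 f th (index_enum_uniq _)).
rewrite /dft_approx (reindex_fsbig freq_row setT) /=; last exact: freq_row_bij.
have -> : [set: grid]%classic = [set` index_enum grid]%classic.
  by apply/seteqP; split=> j //= _; rewrite mem_index_enum.
rewrite -fsbig_seq ?index_enum_uniq //.
rewrite (eq_bigr (fun i : grid => \sum_(j : grid)
   (\prod_l ((N l)%:R^-1 * (fchar (freq (N l) (i l)) (th 0 l) *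
      fchar (- freq (N l) (i l)) (((j l)%:R / (N l)%:R : R)%:C)))) * f (grid_point R j))).
  rewrite exchange_big /=; apply: eq_bigr => j _; rewrite -mulr_suml.
  congr (_ * f _).
    rewrite /grid_weight; under [RHS]eq_bigr do rewrite mem_index_enum mulr_sumr.
    exact: (sum_grid_prod (fun l i => (N l)%:R^-1 * (fchar (freq (N l) i) (th 0 l) *
      fchar (- freq (N l) i) (((j l)%:R / (N l)%:R : R)%:C)))).
  apply/rowP => l; rewrite !mxE mem_index_enum.
  by rewrite rmorphM fmorphV !rmorph_nat.
move=> i _; rewrite /dft_coef -mulrA mulr_suml mulr_sumr.
apply: eq_bigr => j _.
have -> : - phase (freq_row i) (grid_point R j) = phase (- freq_row i) (grid_point R j).
  by rewrite /phase -mulrN -sumrN; congr (_ * _); apply: eq_bigr => l _; rewrite !mxE intrN mulNr.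
have split3 (a b c : 'I_n -> R[i]) :
    \prod_l ((a l)^-1 * (b l * c l)) = (\prod_l a l)^-1 * (\prod_l b l * \prod_l c l).
  by rewrite big_split big_split /= prodfV.
rewrite !cexp_phase split3.
have -> : \prod_l fchar ((- freq_row i) 0 l) (grid_point R j 0 l) =
  \prod_l fchar (- freq (N l) (i l)) (((j l)%:R / (N l)%:R : R)%:C).
  by apply: eq_bigr => l _; rewrite !mxE rmorphM fmorphV !rmorph_nat.
have -> : \prod_l fchar (freq_row i 0 l) (th 0 l) = \prod_l fchar (freq (N l) (i l)) (th 0 l).
  by apply: eq_bigr => l _; rewrite mxE.
move: (\prod_l fchar _ (th 0 l)) (\prod_l fchar _ _) (_^-1) => a b c.
by rewrite -mulrA [RHS]mulrC mulrCA [a * b]mulrC.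
Qed.

End DFT.

(** * The constant and the error estimate *)

Section ConstantCN.
Variables (R : realType) (n : nat) (N : 'I_n -> nat).
Hypothesis N_gt0 : forall l, (0 < N l)%N.

(** The sum over sign vectors is the expansion of the product of the two terms
    of [alias_sumE]; the all-plus term, missing in S*1, is supplied by S*2. *)
Lemma CN_split (rho h : R) : 0 <= rho -> rho < h ->
  CN N rho h = (\prod_l alias_sum (N l) (N l) rho h - \prod_l nu (N l) (h - rho)) +
   (\prod_(l < n) coth (h - rho) - \prod_l nu (N l) (h - rho)).
Proof.
move=> r0 rh; have h0 : 0 < h by apply: le_lt_trans rh.
rewrite /CN; congr (_ + _); last first.
  rewrite /Tconst -/(coth (h - rho)) mulrBr mulr1 prodr_const card_ord; congr (_ - _).
  rewrite -[X in X ^+ n]/(coth (h - rho)).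
  have -> : coth (h - rho) ^+ n = \prod_(l < n) coth (h - rho) by rewrite prodr_const card_ord.
  by rewrite -big_split.
pose D l : R := 1 - expR (- (2 * pi * h * (N l)%:R)).
have D0 l : D l != 0.
  have /andP[_ y1] := expR_decay_lt1 h0 (N_gt0 l).
  by rewrite /D gt_eqF // subr_gt0.
pose F l (b : bool) : R := expR (((-1) ^+ b - 1) * pi * h * (N l)%:R) *
       nu (N l) ((-1) ^+ b * h - rho).
have Ft : \prod_(l < n) F l false = \prod_l nu (N l) (h - rho).
  by apply: eq_bigr => l _; rewrite /F expr0 subrr !mul0r expR0 !mul1r.
have ->: \prod_l alias_sum (N l) (N l) rho h = (\prod_(l < n) (D l)^-1) *
    \sum_(s : {ffun 'I_n -> bool}) \prod_(l < n) F l (s l).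
  rewrite -bigA_distr_bigA -big_split /=; apply: eq_bigr => l _.
  rewrite alias_sumE // big_bool /= mulrC -/(D l); congr (_ * _).
  rewrite addrC /F expr0 expr1 subrr !mul0r expR0 !mul1r; congr (_ + expR _ * nu _ _).
  - ring.
  - ring.
rewrite (bigD1 [ffun=> false]) //=.
have -> : \prod_(l < n) F l ([ffun=> false] l) = \prod_l nu (N l) (h - rho).
  by rewrite -Ft; apply: eq_bigr => l _; rewrite ffunE.
have DV : (\prod_(l < n) (D l)^-1) * \prod_(l < n) D l = 1.
  by rewrite -big_split big1 // => l _; rewrite /= mulVf.
rewrite /Sstar1 /Sstar2 -/(D _) mulrBr mulr1 DV.
rewrite -[\sum_(s | _) \prod_(l < n) (_ * _)]/(\sum_(s : {ffun 'I_n -> bool} | s != [ffun=> false]) \prod_(l < n) F l (s l)).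
ring.
Qed.

Lemma continuous_prod_affine (c : 'I_n -> R) (k : R) (x0 : R) :
  {for x0, continuous (fun e : R => \prod_(l < n) (c l + k * e))}.
Proof.
have E (s : seq 'I_n) : {for x0, continuous (fun e : R => \prod_(l <- s) (c l + k * e))}.
  elim: s => [|l s IH].
    have -> : (fun e : R => \prod_(l <- [::]) (c l + k * e)) = (fun=> 1).
      by apply/funext => e; rewrite big_nil.
    exact: cvg_cst.
  have -> : (fun e : R => \prod_(j <- l :: s) (c j + k * e)) =
     (fun e => (c l + k * e) * \prod_(j <- s) (c j + k * e)).
    by apply/funext => e; rewrite big_cons.
  apply: cvgM => //; apply: cvgD; first exact: cvg_cst.
  by apply: cvgM; [exact: cvg_cst | exact: cvg_id].
exact: E.
Qed.

End ConstantCN.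

Section ErrorEstimate.
Variables (R : realType) (n : nat) (N : 'I_n -> nat).
Hypothesis N_gt0 : forall l, (0 < N l)%N.

(** The approximate splittings give the bound with an extra eps in each factor;
    the products are continuous in eps. *)
Lemma dft_error_pointwise (rho h M : R) (f : 'rV[R[i]]_n -> R[i]) (th : 'rV[R[i]]_n) :
  0 <= rho -> rho < h -> sep_holo h f -> bounded_by h M f ->
  (forall l, `|complex.Im (th 0 l)| <= rho) ->
  normc (dft_approx N f th - f th) <= M * CN N rho h.
Proof.
move=> r0 rh hf fM thr; have h0 : 0 < h by apply: le_lt_trans rh.
have hth : cstrip h th by move=> l; apply: le_lt_trans rh.
have M0 : 0 <= M by apply: le_trans (fM _ hth); exact: normc_ge0.
pose nv l := nu (N l) (h - rho).
pose s := index_enum 'I_n.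
pose Phi (e : R) := (\prod_(l < n) (alias_sum (N l) (N l) rho h + 1 * e) - \prod_(l < n) (nv l + 1 * e)) +
   (\prod_(l < n) (coth (h - rho) + 2 * e) - \prod_(l < n) (nv l + 1 * e)).
have Phi_bound e : 0 < e -> normc (dft_approx N f th - f th) <= M * Phi e.
  move=> e0.
  have [Q HQ] := choice (fun l => one_variable_splitting r0 rh (N_gt0 l) (thr l) e0).
  have HQ1 l : bounded_functional h (Q l) (nv l + e) by have [] := HQ l.
  have HQ2 l : bounded_functional h (grid_partial_sum (N l) (N l) (th 0 l) ++ opp_functional (Q l)) (alias_sum (N l) (N l) rho h - nv l).
    by have [] := HQ l.
  have HQ3 l : bounded_functional h ([:: (1, th 0 l)] ++ opp_functional (Q l)) (coth (h - rho) - nv l + e).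
    by have [] := HQ l.
  have [_ B1] := act_coords_diff_bounded s HQ1 HQ2 hf fM.
  have [_ B2] := act_coords_diff_bounded s HQ1 HQ3 hf fM.
  have := B1 _ hth; have := B2 _ hth.
  rewrite act_coords_eval -dft_approxE //.
  have -> : \row_l (if l \in s then th 0 l else th 0 l) = th.
    by apply/rowP => l; rewrite mxE; case: ifP.
  set F := act_coords s Q f th => C2 C1.
  have -> : dft_approx N f th - f th = (dft_approx N f th - F) - (f th - F) by ring.
  apply: le_trans (le_normcD _ _) _; rewrite normcN; apply: le_trans (lerD C1 C2) _.
  rewrite -mulrDr ler_wpM2l // /Phi.
  rewrite le_eqVlt; apply/orP; left; apply/eqP.
  by congr ((_ - _) + (_ - _)); apply: eq_bigr => l _; ring.
have Phi0 : Phi 0 = CN N rho h.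
  rewrite CN_split // /Phi; congr ((_ - _) + (_ - _)); apply: eq_bigr => l _; by rewrite mulr0 addr0.
have cPhi : {for 0, continuous Phi}.
  apply: cvgD; apply: cvgB; exact: continuous_prod_affine.
apply/ler_addgt0Pr => eta eta0.
have M1 : 0 < M + 1 by rewrite ltr_wpDl.
have /cvgrPdist_le/(_ _ (divr_gt0 eta0 M1)) := cPhi.
move/nbhs_ballP => [d /= d0 H].
have d2 : 0 < d / 2 by rewrite divr_gt0.
have bd : ball 0 d (d / 2).
  by rewrite -ball_normE /= sub0r normrN gtr0_norm //; lra.
have := H _ bd; rewrite /= distrC Phi0 => K.
have K2 : Phi (d / 2) <= CN N rho h + eta / (M + 1).
  by have := ler_norm (Phi (d / 2) - CN N rho h); lra.
apply: le_trans (Phi_bound _ d2) _.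
apply: le_trans (ler_wpM2l M0 K2) _.
rewrite mulrDr lerD2l mulrA ler_pdivrMr // mulrC ler_wpM2l ?(ltW eta0) //.
by rewrite lerDl.
Qed.

End ErrorEstimate.

Theorem theorem3p3 (R : realType) (n : nat) (N : 'I_n -> nat)
    (rho rhohat : R) (f : 'rV[R[i]]_n -> R[i])
    (N_gt0 : forall l : 'I_n, (0 < N l)%N)
    (rhohat_gt0 : 0 < rhohat)
    (f_periodic : periodic_on (cstrip rhohat) f)
    (f_analytic : analytic_on (cstrip rhohat) f)
    (f_bounded : bounded_on (cstrip rhohat) f)
    (rho_ge0 : 0 <= rho) (rho_lt : rho < rhohat) :
  (supnorm rho (fun theta => dft_approx N f theta - f theta)%R
    <= (CN N rho rhohat)%:E * supnorm rhohat f)%E.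
Proof.
have hf := analytic_sep_holo f_periodic f_analytic.
have in_sup th : cstrip rhohat th -> ((normc (f th))%:E <= supnorm rhohat f)%E.
  move=> hth; apply: ereal_sup_ubound; exists th => //.
  by rewrite gt_eqF.
have zero_in : cstrip rhohat (0 : 'rV[R[i]]_n).
  by move=> l; rewrite mxE /in_strip /= normr0.
have sup_fin : supnorm rhohat f \is a fin_num.
  have [M HM] := f_bounded.
  rewrite fin_numElt; apply/andP; split.
    by apply: lt_le_trans (in_sup _ zero_in); rewrite ltNyr.
  apply: le_lt_trans (ltry M); apply: ge_ereal_sup => _ [th + <-].
  by rewrite gt_eqF // lee_fin; exact: HM.
have fM : bounded_by rhohat (fine (supnorm rhohat f)) f.
  by move=> th hth; rewrite -lee_fin fineK //; exact: in_sup.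
apply: ge_ereal_sup => _ [th thU <-].
rewrite -(fineK sup_fin) -EFinM lee_fin mulrC.
apply: dft_error_pointwise => // l; move: thU.
case: ifP => _ thU; first by rewrite thU normr0.
by apply: ltW; exact: thU.
Qed.
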